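(* Let $\mathcal{R}:\mathbb{X}\to\mathbb{Y}$ be an $\varepsilon_0$-LDP local randomizer (for some $\varepsilon_0\ge 0$) and let $\mathcal{M}_S=\mathcal{S}\circ\mathcal{R}^n$ be the shuffling of $\mathcal{R}$. Fix $\varepsilon\ge0$ and neighboring inputs $X^0=(x_1^0,x_2,\dots,x_n)$, $X^1=(x_1^1,x_2,\dots,x_n)$ in $\mathbb{X}^n$ with $x_1^0\ne x_1^1$. Suppose $G_1,G_2,\dots$ are i.i.d. copies of the generalized privacy amplification random variable $G_\varepsilon^{x_1^0,x_1^1}$. Then $$D_{e^\varepsilon}\big(\mathcal{M}_S(X^0)\,\|\,\mathcal{M}_S(X^1)\big)\le D_{e^\varepsilon}\big(P_0^{\mathsf{B}}\,\|\,P_1^{\mathsf{B}}\big)=\frac1n\,\mathbb{E}\Big[\sum_{i=1}^nG_i\Big]_+,$$ where $(P_0^{\mathsf{B}},P_1^{\mathsf{B}})$ is the privacy blanket reduction pair and $\mathbb{E}[Z]_+$ denotes $\mathbb{E}[\max\{0,Z\}]$.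
   Context: A local randomizer $\mathcal{R}:\mathbb{X}\to\mathbb{Y}$ is a randomized map; $\mathcal{R}(x)$ is its output distribution on input $x$ and $\mathcal{R}(x)(y)$ its density at $y$ with respect to a fixed reference measure on $\mathbb{Y}$ (counting measure if $\mathbb{Y}$ is discrete); $y\mapsto\inf_x\mathcal{R}(x)(y)$ is assumed measurable. $\varepsilon_0$-LDP means $\mathcal{R}(x)(y)\le e^{\varepsilon_0}\mathcal{R}(x')(y)$ for all $x,x'\in\mathbb{X}$ and $y\in\mathbb{Y}$. Hockey-stick divergence: $D_\alpha(P\|Q)=\int\max\{0,P(x)-\alpha Q(x)\}\,dx$, with $P(\cdot),Q(\cdot)$ densities with respect to a common reference measure. Shuffling: $\mathcal{M}_S(x_1,\dots,x_n)=\mathcal{S}(\mathcal{R}(x_1),\dots,\mathcal{R}(x_n))$, the $\mathcal{R}(x_i)$ sampled independently and $\mathcal{S}$ applying an independent uniformly random permutation. Privacy blanket: $\gamma=\int\inf_{x\in\mathbb{X}}\mathcal{R}(x)(y)\,dy$ and $\omega(y)=\inf_{x\in\mathbb{X}}\mathcal{R}(x)(y)/\gamma$, a probability density. For $a\in\{0,1\}$, $P_a^{\mathsf{B}}$ is the distribution of $(|\boldsymbol b|,Y^a_{|\boldsymbol b|})$, where $|\boldsymbol b|\sim\mathrm{Bin}(n-1,\gamma)$ and, given $|\boldsymbol b|=m$, $Y^a_m$ is the multiset consisting of one sample from $\mathcal{R}(x_1^a)$ and $m$ independent samples from $\omega$. Privacy amplification random variable (PARV) and generalized PARV (GPARV):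 for $W\sim\omega$ and $x,x'\in\mathbb{X}$, $$L_\varepsilon^{x,x'}=\frac{\mathcal{R}(x)(W)-e^\varepsilon\mathcal{R}(x')(W)}{\omega(W)},$$ and $G_\varepsilon^{x,x'}$ equals $\frac1\gamma L_\varepsilon^{x,x'}$ with probability $\gamma$ and equals $0$ with probability $1-\gamma$ (the choice being independent of $W$). *)

(* Defs.v *)
From HB Require Import structures.
From mathcomp Require Import all_boot all_order all_algebra perm finmap.
From mathcomp Require multiset.
From mathcomp Require Import all_classical all_reals all_analysis.
From mathcomp Require Import measurable_realfun.

Set Implicit Arguments.
Unset Strict Implicit.
Unset Printing Implicit Defensive.
Import Order.TTheory GRing.Theory Num.Theory.
Import numFieldNormedType.Exports.

Local Open Scope classical_set_scope.
Local Open Scope ring_scope.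

Section sum_of_finite_measures.
Context d (T : measurableType d) (R : realType).
Variables P Q : {finite_measure set T -> \bar R}.

HB.instance Definition _ := Measure.on (measure_add P Q).

Let measure_add_fin : fin_num_fun (measure_add P Q).
Proof.
by move=> A mA; rewrite measure_addE fin_numD !fin_num_measure.
Qed.

HB.instance Definition _ :=
  Measure_isFinite.Build _ _ _ (measure_add P Q) measure_add_fin.

End sum_of_finite_measures.

Section hockey_stick.
Context d (T : measurableType d) (R : realType).
Local Open Scope ereal_scope.
Local Open Scope charge_scope.

(* The densities are taken with respect to P + Q, a common reference measure
   that always exists; [hockey_stickE] shows that any other common reference
   measure gives the same value. *)
Definition hockey_stick (alpha : R) (P Q : probability T R) : \bar R :=
  let nu := measure_add P Q in
  \int[nu]_x maxe 0 (('d (charge_of_finite_measure P) '/d nu) x -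
                     alpha%:E * ('d (charge_of_finite_measure Q) '/d nu) x).

Let maxB_integrable (mu : {measure set T -> \bar R}) (alpha : R)
    (p q : T -> \bar R) :
  mu.-integrable setT p -> mu.-integrable setT q ->
  mu.-integrable setT (fun x => p x - alpha%:E * q x).
Proof. by move=> ip iq; apply: integrableB => //; exact: integrableZl. Qed.

Let int_max_ge (mu : {measure set T -> \bar R}) (alpha : R) (P Q : probability T R)
    (p q : T -> \bar R) B :
  mu.-integrable setT p -> mu.-integrable setT q ->
  (forall A, measurable A -> P A = \int[mu]_(x in A) p x) ->
  (forall A, measurable A -> Q A = \int[mu]_(x in A) q x) ->
  measurable B ->
  P B - alpha%:E * Q B <= \int[mu]_x maxe 0 (p x - alpha%:E * q x).
Proof.
move=> ip iq Pp Qq mB.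
have iB := maxB_integrable alpha ip iq.
have subi f : mu.-integrable setT f -> mu.-integrable B f.
  by move=> fi; apply: integrableS fi.
have ip' := integrable_funepos measurableT iB.
have maxE : (fun x => maxe 0 (p x - alpha%:E * q x)) =
    (fun x => p x - alpha%:E * q x)^\+.
  by apply/funext => x; rewrite funeposE maxC.
rewrite maxE.
rewrite Pp// Qq// -integralZl; [|by []|exact: subi].
rewrite -integralB; [|by []|exact: subi|by apply: subi; exact: integrableZl].
apply: (@le_trans _ _
    (\int[mu]_(x in B) (fun x => p x - alpha%:E * q x)^\+ x)).
  apply: le_integral => //; [exact: subi|exact: subi|].
  by move=> x _; rewrite funeposE le_max lexx.
by apply: ge0_subset_integral => //; exact: measurable_int ip'.
Qed.

Let int_max_eq (mu : {measure set T -> \bar R}) (alpha : R) (P Q : probability T R)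
    (p q : T -> \bar R) :
  mu.-integrable setT p -> mu.-integrable setT q ->
  (forall A, measurable A -> P A = \int[mu]_(x in A) p x) ->
  (forall A, measurable A -> Q A = \int[mu]_(x in A) q x) ->
  exists2 B, measurable B &
  \int[mu]_x maxe 0 (p x - alpha%:E * q x) = P B - alpha%:E * Q B.
Proof.
move=> ip iq Pp Qq.
have iB := maxB_integrable alpha ip iq.
have mm := measurable_int _ iB.
set B := [set x | 0 < p x - alpha%:E * q x].
have mB : measurable B.
  have -> : B = setT `&` [set x | 0 < p x - alpha%:E * q x] by rewrite setTI.
  exact: emeasurable_fun_o_infty.
exists B => //.
have subi f : mu.-integrable setT f -> mu.-integrable B f.
  by move=> fi; apply: integrableS fi.
rewrite Pp// Qq// -integralZl; [|by []|exact: subi].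
rewrite -integralB; [|by []|exact: subi|by apply: subi; exact: integrableZl].
rewrite [RHS]integral_mkcond; apply: eq_integral => x _.
rewrite patchE; case: ifPn => [|]; rewrite ?inE ?notin_setE /B /= => h.
  by apply/max_idPr; exact: ltW.
by apply/max_idPl; rewrite leNgt; apply/negP.
Qed.

Lemma hockey_stickE (alpha : R) (P Q : probability T R)
    (mu : {measure set T -> \bar R}) (p q : T -> \bar R) :
  mu.-integrable setT p -> mu.-integrable setT q ->
  (forall A, measurable A -> P A = \int[mu]_(x in A) p x) ->
  (forall A, measurable A -> Q A = \int[mu]_(x in A) q x) ->
  hockey_stick alpha P Q = \int[mu]_x maxe 0 (p x - alpha%:E * q x).
Proof.
move=> ip iq Pp Qq; rewrite /hockey_stick /=.
set nu := measure_add P Q.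
have dom (S : probability T R) : (forall A, S A <= nu A) ->
    charge_of_finite_measure S `<< nu.
  move=> SA; apply/null_content_dominatesP => A mA nuA.
  by apply/eqP; rewrite eq_le measure_ge0 andbT -nuA SA.
have dP : charge_of_finite_measure P `<< nu.
  by apply: dom => A; rewrite /nu measure_addE leeDl.
have dQ : charge_of_finite_measure Q `<< nu.
  by apply: dom => A; rewrite /nu measure_addE leeDr.
have iP := Radon_Nikodym_integrable dP.
have iQ := Radon_Nikodym_integrable dQ.
have PP A : measurable A -> P A = _ := Radon_Nikodym_integral dP.
have QQ A : measurable A -> Q A = _ := Radon_Nikodym_integral dQ.
apply/eqP; rewrite eq_le; apply/andP; split.
  have [B mB ->] := int_max_eq alpha iP iQ PP QQ.
  exact: int_max_ge.
have [B mB ->] := int_max_eq alpha ip iq Pp Qq.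
exact: (int_max_ge _ iP iQ PP QQ).
Qed.

End hockey_stick.

Section law_of_density.
Context d (Y : measurableType d) (R : realType).
Variables (mu : {measure set Y -> \bar R}) (f : Y -> R).
Local Open Scope ereal_scope.

Definition is_pdf : Prop :=
  [/\ measurable_fun setT f, forall y, (0 <= f y)%R & \int[mu]_y (f y)%:E = 1].

(* Total, so as to be a probability unconditionally: the value when f is not
   a probability density is irrelevant. *)
Definition pdf_law (A : set Y) : \bar R :=
  if `[< is_pdf >] then \int[mu]_(y in A) (f y)%:E else \d_point A.

Let pdf_law0 : pdf_law set0 = 0.
Proof. by rewrite /pdf_law; case: ifP => _; rewrite ?integral_set0 ?measure0. Qed.

Let pdf_law_ge0 A : 0 <= pdf_law A.
Proof.
rewrite /pdf_law; case: ifPn => [/asboolP[_ f0 _]|_]; last exact: measure_ge0.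
by apply: integral_ge0 => y _; rewrite lee_fin.
Qed.

Let pdf_law_sigma_additive : semi_sigma_additive pdf_law.
Proof.
rewrite /pdf_law => F mF tF mUF; case: ifPn => [/asboolP[mf f0 _]|_]; last first.
  exact: measure_semi_sigma_additive.
rewrite ge0_integral_bigcup//; first last.
- by move=> y _; rewrite lee_fin.
- by apply: measurable_funTS; exact/measurable_EFinP.
apply: is_cvg_ereal_nneg_natsum_cond => n _ _.
by apply: integral_ge0 => y _; rewrite lee_fin.
Qed.

HB.instance Definition _ := isMeasure.Build _ _ _ pdf_law
  pdf_law0 pdf_law_ge0 pdf_law_sigma_additive.

Let pdf_law_setT : pdf_law setT = 1.
Proof. by rewrite /pdf_law; case: ifPn => [/asboolP[]//|_]; rewrite diracT. Qed.

HB.instance Definition _ :=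
  Measure_isProbability.Build _ _ _ pdf_law pdf_law_setT.

End law_of_density.

Section tuple_maps.
Context d (Y : measurableType d) (n : nat).

Definition cons_pair (z : Y * n.-tuple Y) : n.+1.-tuple Y := [tuple of z.1 :: z.2].

Let measurable_cons_pair : measurable_fun setT cons_pair.
Proof. exact: measurable_cons. Qed.

HB.instance Definition _ :=
  isMeasurableFun.Build _ _ _ _ cons_pair measurable_cons_pair.

Definition permute (s : 'S_n) (t : n.-tuple Y) : n.-tuple Y :=
  [tuple tnth t (s i) | i < n].

Let measurable_permute s : measurable_fun setT (permute s).
Proof.
apply/measurable_fun_tnthP => i.
rewrite (_ : _ \o _ = (@tnth n Y)^~ (s i)); first exact: measurable_tnth.
by apply/funext => t /=; rewrite tnth_mktuple.
Qed.

HB.instance Definition _ s :=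
  isMeasurableFun.Build _ _ _ _ (permute s) (measurable_permute s).

End tuple_maps.

(* Law of (Z_0, ..., Z_(n-1)) for independent Z_i with laws P i. *)
Fixpoint independent_law d (Y : measurableType d) (R : realType) (n : nat) :
    ('I_n -> probability Y R) -> probability (n.-tuple Y) R :=
  match n return ('I_n -> probability Y R) -> probability (n.-tuple Y) R with
  | 0%N => fun _ => \d_([tuple] : 0.-tuple Y)
  | k.+1 => fun P => distribution
      (P ord0 \x independent_law (fun i => P (lift ord0 i)))%E
      (@cons_pair _ Y k)
  end.

Section shuffle.
Context d (Y : measurableType d) (R : realType) (n : nat).
Variable P : probability (n.-tuple Y) R.
Local Open Scope ereal_scope.

Definition shuffle (A : set (n.-tuple Y)) : \bar R :=
  (n`!%:R^-1)%:E * \sum_(s : 'S_n) distribution P (permute s) A.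

Let shuffle0 : shuffle set0 = 0.
Proof. by rewrite /shuffle big1 ?mule0// => s _; rewrite measure0. Qed.

Let shuffle_ge0 A : 0 <= shuffle A.
Proof. by rewrite /shuffle mule_ge0 ?sume_ge0// lee_fin invr_ge0. Qed.

Let shuffle_sigma_additive : semi_sigma_additive shuffle.
Proof.
move=> F mF tF mUF; rewrite /shuffle.
rewrite [X in X @ _ --> _](_ : _ = fun k => (n`!%:R^-1)%:E *
    \sum_(s : 'S_n) \sum_(0 <= i < k) distribution P (permute s) (F i)).
  apply: cvgeZl => //; apply: cvg_nnesum => [s _|s _].
    by apply: nearW => k; exact: sume_ge0.
  exact: measure_semi_sigma_additive.
apply/funext => k; rewrite -ge0_sume_distrr; last by move=> *; exact: sume_ge0.
by rewrite exchange_big.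
Qed.

HB.instance Definition _ := isMeasure.Build _ _ _ shuffle
  shuffle0 shuffle_ge0 shuffle_sigma_additive.

Let shuffle_setT : shuffle setT = 1.
Proof.
rewrite /shuffle (eq_bigr (fun=> 1%:E)) => [|s _]; last exact: probability_setT.
by rewrite sumEFin sumr_const card_Sn -EFinM mulVf// pnatr_eq0 -lt0n fact_gt0.
Qed.

HB.instance Definition _ :=
  Measure_isProbability.Build _ _ _ shuffle shuffle_setT.

End shuffle.

Section multisets.
Context d (Y : measurableType d).

Definition mset_of : Type := multiset.multiset_of (Phant Y).

HB.instance Definition _ := Choice.on mset_of.
HB.instance Definition _ :=
  isPointed.Build mset_of (multiset.seq_mset [::]).

Definition tuple_mset n (t : n.-tuple Y) : mset_of := multiset.seq_mset t.

(* The quotient sigma-algebra: a set of multisets is measurable when its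
   preimage in each Y^n is. *)
Definition mset_measurable : set (set mset_of) :=
  [set A | forall n, measurable (@tuple_mset n @^-1` A)].

Let mset_measurable0 : mset_measurable set0.
Proof. by move=> n; rewrite preimage_set0. Qed.

Let mset_measurableC A : mset_measurable A -> mset_measurable (~` A).
Proof. by move=> mA n; rewrite preimage_setC; apply: measurableC; exact: mA. Qed.

Let mset_measurable_bigcup (F : (set mset_of)^nat) :
  (forall i, mset_measurable (F i)) -> mset_measurable (\bigcup_i F i).
Proof.
move=> mF n; rewrite preimage_bigcup; apply: bigcupT_measurable => i.
exact: mF.
Qed.

HB.instance Definition _ := @isMeasurable.Build (measure_tuple_display d)
  mset_of mset_measurable mset_measurable0 mset_measurableC
  mset_measurable_bigcup.

Let measurable_tuple_mset n : measurable_fun setT (@tuple_mset n).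
Proof. by move=> _ A mA; rewrite setTI; exact: mA. Qed.

HB.instance Definition _ n :=
  isMeasurableFun.Build _ _ _ _ (@tuple_mset n) (@measurable_tuple_mset n).

End multisets.

Section joint_law.
Context d (T : measurableType d) (R : realType).
Variables (p : probability nat R) (K : nat -> probability T R).
Local Open Scope ereal_scope.

(* Law of (b, Z) for b of law p and Z of law K m given b = m. *)
Definition joint_law (A : set (nat * T)) : \bar R :=
  \int[p]_m K m (xsection A m).

Let joint_law0 : joint_law set0 = 0.
Proof.
by rewrite /joint_law integral0_eq// => m _; rewrite xsection0 measure0.
Qed.

Let joint_law_ge0 A : 0 <= joint_law A.
Proof. exact: integral_ge0. Qed.

Let joint_law_sigma_additive : semi_sigma_additive joint_law.
Proof.
move=> F mF tF mUF; rewrite /joint_law.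
rewrite [X in _ --> X](_ : _ = \int[p]_m \sum_(i <oo) K m (xsection (F i) m)).
  rewrite integral_nneseries//.
  by apply: is_cvg_ereal_nneg_natsum => i _; exact: integral_ge0.
apply: eq_integral => m _; rewrite xsection_bigcup.
apply: measure_semi_bigcup => //.
- by move=> i; exact: measurable_xsection.
- exact: trivIset_xsection.
- by rewrite -xsection_bigcup; exact: measurable_xsection.
Qed.

HB.instance Definition _ := isMeasure.Build _ _ _ joint_law
  joint_law0 joint_law_ge0 joint_law_sigma_additive.

Let joint_law_setT : joint_law setT = 1.
Proof.
rewrite /joint_law (eq_integral (cst 1)) => [|m _]; last first.
  by rewrite xsectionE preimage_setT probability_setT.
by rewrite integral_cst//= mul1e; exact: probability_setT.
Qed.

HB.instance Definition _ :=
  Measure_isProbability.Build _ _ _ joint_law joint_law_setT.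

End joint_law.

(* A local randomizer is given by the densities r x of its output
   distributions with respect to the reference measure mu. *)
Section randomizer.
Context (X : Type) d (Y : measurableType d) (R : realType).
Variables (mu : {measure set Y -> \bar R}) (r : X -> Y -> R).

Definition inf_density (y : Y) : R := inf [set r x y | x in [set: X]].

Definition local_randomizer : Prop :=
  (forall x, is_pdf mu (r x)) /\ measurable_fun setT inf_density.

Definition LDP (eps0 : R) : Prop :=
  forall (x x' : X) (y : Y), r x y <= expR eps0 * r x' y.

Definition output_law (x : X) : probability Y R := pdf_law mu (r x).

Definition shuffled n (xs : n.-tuple X) : probability (n.-tuple Y) R :=
  shuffle (independent_law (fun i => output_law (tnth xs i))).

Definition blanket_mass : R := \int[mu]_y inf_density y.

Definition blanket_density (y : Y) : R := inf_density y / blanket_mass.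

Definition blanket_law : probability Y R := pdf_law mu blanket_density.

Definition blanket_mset (x : X) (m : nat) : probability (mset_of Y) R :=
  distribution
    (independent_law (fun i : 'I_m.+1 =>
       if i == ord0 then output_law x else blanket_law))
    (@tuple_mset _ Y m.+1).

(* n is the number of users. *)
Definition blanket_pair (n : nat) (x : X) : probability (nat * mset_of Y)%type R :=
  joint_law (binomial_prob n.-1 blanket_mass) (blanket_mset x).

Definition PARV (eps : R) (x x' : X) (w : Y) : R :=
  (r x w - expR eps * r x' w) / blanket_density w.

(* z = (W, c) with c the Bernoulli(gamma) choice, independent of W. *)
Definition GPARV (eps : R) (x x' : X) (z : Y * bool) : R :=
  if z.2 then blanket_mass^-1 * PARV eps x x' z.1 else 0.

Definition GPARV_law (eps : R) (x x' : X) : set R -> \bar R :=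
  pushforward (blanket_law \x bernoulli_prob blanket_mass)%E (GPARV eps x x').

(* Under LDP neither binomial_prob, bernoulli_prob nor pdf_law is used outside
   its intended range. *)
Lemma blanket_pdf (eps0 : R) (x : X) :
  local_randomizer -> LDP eps0 ->
  0 < blanket_mass <= 1 /\ is_pdf mu blanket_density.
Proof.
move=> [rpdf mh] ldp.
have [mrx rx0 rx1] := rpdf x.
have hr y : inf_density y <= r x y.
  apply: ge_inf; last by exists x.
  by exists 0 => _ [x' _ <-]; have [_ /(_ y)] := rpdf x'.
have h0 y : 0 <= inf_density y.
  apply: lb_le_inf; first by exists (r x y); exists x.
  by move=> _ [x' _ <-]; have [_ /(_ y)] := rpdf x'.
have rh y : expR (- eps0) * r x y <= inf_density y.
  apply: lb_le_inf; first by exists (r x y); exists x.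
  move=> _ [x' _ <-]; rewrite expRN mulrC ler_pdivrMr ?expR_gt0// mulrC.
  exact: ldp.
have mE (f : Y -> R) : measurable_fun setT f -> measurable_fun setT (EFin \o f).
  by move=> mf; exact/measurable_EFinP.
have I1 : (\int[mu]_y (inf_density y)%:E <= 1)%E.
  rewrite -rx1; apply: ge0_le_integral => //; try exact: mE.
  - by move=> y _; rewrite lee_fin.
  - by move=> y _; rewrite lee_fin.
have I0 : ((expR (- eps0))%:E <= \int[mu]_y (inf_density y)%:E)%E.
  rewrite -[leLHS]mule1 -rx1 -ge0_integralZl//; last 2 first.
  - exact: mE.
  - by move=> y _; rewrite lee_fin.
  apply: ge0_le_integral => //.
  - by move=> y _; rewrite -EFinM lee_fin mulr_ge0// expR_ge0.
  - by apply: measurable_funeM; exact: mE.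
  - exact: mE.
  - by move=> y _; rewrite -EFinM lee_fin.
have bmE : (\int[mu]_y (inf_density y)%:E)%E = blanket_mass%:E.
  rewrite /blanket_mass /Rintegral fineK// ge0_fin_numE.
    by rewrite (le_lt_trans I1)// ltry.
  by apply: integral_ge0 => y _; rewrite lee_fin.
have bm0 : 0 < blanket_mass.
  by rewrite -lte_fin -bmE (lt_le_trans _ I0)// lte_fin expR_gt0.
split; first by rewrite bm0 /= -lee_fin -bmE.
split.
- exact: measurable_funM.
- by move=> y; rewrite divr_ge0// ltW.
- under eq_integral do rewrite /blanket_density mulrC EFinM.
  rewrite ge0_integralZl//.
  + by rewrite bmE -EFinM mulVf// gt_eqF.
  + exact: mE.
  + by move=> y _; rewrite lee_fin.
  + by rewrite lee_fin invr_ge0 ltW.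
Qed.

End randomizer.

Section independence.
Context d (Omega : measurableType d) (R : realType) (P : probability Omega R).

Definition mutually_independent (I : choiceType) (Z : I -> {RV P >-> R}) : Prop :=
  forall (J : {fset I}) (B : I -> set R), (forall i, measurable (B i)) ->
  P (\bigcap_(i in [set` J]) (Z i @^-1` B i)) =
    (\prod_(i <- J) P (Z i @^-1` B i))%E.

Definition iid_copies (I : choiceType) (Z : I -> {RV P >-> R})
    (law : set R -> \bar R) : Prop :=
  mutually_independent Z /\
  forall i A, measurable A -> distribution P (Z i) A = law A.

End independence.

(* Main.v *)
(* The blanket law W has density omega = inf_x r x / gamma, and by LDP every
   R(x) has a density p_x with respect to W, with p_x >= gamma; put
   L = p_{x10} - e^eps p_{x11}, which is the PARV, and
   psi_m = E[max(0, L(W_1) + ... + L(W_m))] for W_1, ..., W_m iid of law W.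
   - Given |b| = m, averaging over the position of the distinguished sample
     shows that the multiset has density (p_x(W_1) + ... + p_x(W_(m+1))) / (m+1)
     with respect to the multiset of m + 1 samples of W.  So the hockey-stick
     divergence of the blanket pair is E[psi_(m+1) / (m+1)], m ~ Bin(n-1, gamma).
   - Expanding each p_(x_j) = gamma + l_j over the sets S of users that imitate
     the blanket, the difference of the shuffled densities becomes a sum over S.
     After averaging over permutations, the factor L(W_0) can be replaced by the
     mean of L over S and the first user; sublinearity of max(0, .) then bounds
     the S-term by (1 - gamma)^(n-1-|S|) gamma^|S| psi_(|S|+1) / (|S|+1).
   - E[G_1 + ... + G_n]_+ = E[psi_M] / gamma with M ~ Bin(n, gamma), and
     C(n, m+1) (m+1) = n C(n-1, m) matches this with the first formula. *)

Require Import Defs.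
From HB Require Import structures.
From mathcomp Require Import all_boot all_order all_algebra perm finmap.
From mathcomp Require Import all_classical all_reals all_analysis.
From mathcomp Require Import measurable_realfun ring.

Set Implicit Arguments.
Unset Strict Implicit.
Unset Printing Implicit Defensive.
Import Order.TTheory GRing.Theory Num.Theory.
Import numFieldNormedType.Exports.

Local Open Scope classical_set_scope.
Local Open Scope ring_scope.

(** * Integration against a measure given by a density *)

Section integral_density.
Local Open Scope ereal_scope.
Context d (T : measurableType d) (R : realType).
Variables (mu P : {measure set T -> \bar R}) (q : T -> R).
Hypotheses (mq : measurable_fun setT q) (q0 : forall x, (0 <= q x)%R).
Hypothesis PE : forall A, measurable A -> P A = \int[mu]_(x in A) (q x)%:E.

Import HBNNSimple.

(** For simple functions this is [PE] applied to the level sets; monotone convergence on both sides,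
    along the same approximating sequence, gives the general case. *)
Lemma ge0_integral_density (f : T -> \bar R) :
  measurable_fun setT f -> (forall x, 0 <= f x) ->
  \int[P]_x f x = \int[mu]_x (f x * (q x)%:E).
Proof.
move=> mf f0; pose h := nnsfun_approx measurableT mf.
have mqE : measurable_fun setT (EFin \o q) by exact/measurable_EFinP.
have q0E x : 0 <= (q x)%:E by rewrite lee_fin.
have hq n : \int[P]_x (h n x)%:E = \int[mu]_x ((h n x)%:E * (q x)%:E).
  have mi r : measurable_fun setT
      (fun x => (r * \1_(h n @^-1` [set r]) x)%:E : \bar R).
    by apply/measurable_EFinP/measurable_funM.
  under eq_integral do rewrite fimfunE -fsumEFin//.
  rewrite ge0_integral_fsum//; last by move=> r x _; exact: nnfun_muleindic_ge0.
  under [RHS]eq_integral => x _.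
    rewrite fimfunE -fsumEFin// ge0_mule_fsuml => [|y]; last first.
      exact: nnfun_muleindic_ge0.
    over.
  rewrite ge0_integral_fsum//; last 2 first.
  - by move=> r; exact: emeasurable_funM.
  - by move=> r x _; rewrite mule_ge0// nnfun_muleindic_ge0.
  apply: eq_fsbigr => r; rewrite inE => -[x0 _ <-].
  set A := h n @^-1` _.
  have mA : measurable A by exact: measurable_sfunP.
  under [RHS]eq_integral do rewrite EFinM -muleA.
  rewrite [RHS]ge0_integralZl//; last 3 first.
  - apply: emeasurable_funM => //.
    by apply/measurable_EFinP.
  - by move=> x _; rewrite mule_ge0// lee_fin.
  - by rewrite lee_fin.
  under [LHS]eq_integral do rewrite EFinM.
  rewrite ge0_integralZl//; last by rewrite lee_fin.
  - congr (_ * _); rewrite integral_indic// setIT PE// [LHS]integral_mkcond.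
    apply: eq_integral => x _; rewrite patchE indicE.
    by case: ifPn; rewrite ?mul1e ?mul0e.
  exact/measurable_EFinP.
have lef x i j : (i <= j)%N -> (h i x <= h j x)%R.
  by move=> ij; exact/lefP/nd_nnsfun_approx.
have hf x : (h n x)%:E @[n --> \oo] --> f x.
  by apply: cvg_nnsfun_approx => // *; exact: f0.
transitivity (limn (fun n => \int[P]_x (h n x)%:E)).
  rewrite -monotone_convergence//.
  - by apply: eq_integral => x _; apply/esym/cvg_lim => //; exact: hf.
  - by move=> n; exact/measurable_EFinP.
  - by move=> n x _; rewrite lee_fin.
  - by move=> x _ m n mn; rewrite lee_fin lef.
under eq_fun do rewrite hq.
rewrite -monotone_convergence//.
- apply: eq_integral => x _; apply/cvg_lim => //; apply: cvgeZr => //.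
- by move=> n; apply: emeasurable_funM => //; exact/measurable_EFinP.
- by move=> n x _; rewrite mule_ge0// lee_fin.
- by move=> x _ m n mn; rewrite lee_wpmul2r// lee_fin lef.
Qed.

End integral_density.

Lemma patch_indicE (R : realType) (T : Type) (f : T -> \bar R) (A : set T) x :
  (f \_ A) x = ((\1_A x)%:E * f x)%E.
Proof. by rewrite patchE indicE; case: ifPn; rewrite ?mul1e ?mul0e. Qed.

(** * Product laws on tuples: boxes, Tonelli, permutations and densities *)

Section independent_law_theory.
Local Open Scope ereal_scope.
Context d (Y : measurableType d) (R : realType).

Definition box n (B : 'I_n -> set Y) : set (n.-tuple Y) :=
  [set t | forall i, B i (tnth t i)].

Lemma boxE n (B : 'I_n -> set Y) :
  box B = \big[setI/setT]_(i < n) (tnth (T := Y) ^~ i @^-1` B i).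
Proof.
rewrite -bigcap_seq; apply/seteqP; split => t /= Bt i.
  by move=> _; exact: Bt.
by apply: Bt; rewrite /= mem_index_enum.
Qed.

Lemma measurable_box n (B : 'I_n -> set Y) :
  (forall i, measurable (B i)) -> measurable (box B).
Proof.
move=> mB; rewrite boxE; apply: bigsetI_measurable => i _.
by rewrite -[X in measurable X]setTI; apply: measurable_tnth.
Qed.

(** Boxes are stable under intersection and generate the product sigma-algebra, so the uniqueness
    theorem for finite measures applies. *)
Lemma box_unique n (P Q : probability (n.-tuple Y) R) :
  (forall B, (forall i, measurable (B i)) -> P (box B) = Q (box B)) ->
  forall A, measurable A -> P A = Q A.
Proof.
move=> PQ A mA.
pose G : set (set (n.-tuple Y)) :=
  [set C | exists2 B, forall i, measurable (B i) & C = box B].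
apply: (@measure_unique _ R _ G (fun=> setT)) => //.
- apply/seteqP; split; last first.
    apply: smallest_sub; first exact: sigma_algebra_measurable.
    by move=> _ [B mB ->]; exact: measurable_box.
  apply: sub_smallest2r; first exact: smallest_sigma_algebra.
  rewrite -bigcup_seq => _ [i _ [C mC <-]].
  (* A cylinder over the single coordinate [i] is a box with full sides elsewhere. *)
  exists (fun j => if j == i then C else setT).
    by move=> j; case: ifP.
  rewrite setTI; apply/seteqP; split => t /=.
    by move=> Ct j; case: ifPn => // /eqP ->.
  by move=> /(_ i); rewrite eqxx.
- move=> _ _ [B mB ->] [C mC ->]; exists (fun i => B i `&` C i).
    by move=> i; exact: measurableI.
  by apply/seteqP; split => t /=; [move=> [+ +] i|move=> BC; split => i];
    [move=> /(_ i) ? /(_ i)|have [] := BC i|have [] := BC i].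
- by move=> _; exists (fun=> setT) => //; apply/seteqP; split.
- by apply/seteqP; split => // t _; exists 0%N.
- by move=> _ [B mB ->]; exact: PQ.
- by move=> _; rewrite -ge0_fin_numE// fin_num_measure.
Qed.

Lemma ge0_integral_independent_lawS n (P : 'I_n.+1 -> probability Y R)
    (f : n.+1.-tuple Y -> \bar R) :
  measurable_fun setT f -> (forall t, 0 <= f t) ->
  \int[independent_law P]_t f t =
  \int[P ord0]_y \int[independent_law (fun i => P (lift ord0 i))]_t
    f (cons_pair (y, t)).
Proof.
move=> mf f0 /=; rewrite ge0_integral_distribution// fubini_tonelli1//=.
exact: measurableT_comp.
Qed.

Lemma measurable_ge0_integral_cons n (Q : probability (n.-tuple Y) R)
    (f : n.+1.-tuple Y -> \bar R) :
  measurable_fun setT f -> (forall t, 0 <= f t) ->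
  measurable_fun setT (fun y => \int[Q]_t f (cons_pair (y, t))).
Proof.
move=> mf f0.
apply: (measurable_fun_fubini_tonelli_F (fun z => f (cons_pair z))) => //.
exact: measurableT_comp.
Qed.

Lemma independent_law_box n (P : 'I_n -> probability Y R) (B : 'I_n -> set Y) :
  (forall i, measurable (B i)) ->
  independent_law P (box B) = \prod_(i < n) P i (B i).
Proof.
elim: n P B => [|n IH] P B mB /=.
  by rewrite big_ord0 diracE mem_set// => -[].
rewrite big_ord_recl -IH// -product_measure1E//; last exact: measurable_box.
rewrite /distribution /pushforward; congr (product_measure1 _ _ _).
apply/seteqP; split => -[y t] /=.
  move=> Bt; split; first by have := Bt ord0; rewrite tnth0.
  by move=> i; have := Bt (lift ord0 i); rewrite tnthS.
move=> [By Bt] i; have [j ->|->] := unliftP ord0 i; last by rewrite tnth0.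
by rewrite tnthS; exact: Bt.
Qed.

Lemma tnth_permute n (s : 'S_n) (t : n.-tuple Y) i :
  tnth (permute s t) i = tnth t (s i).
Proof. by rewrite tnth_mktuple. Qed.

(** The preimage of a box is the box with permuted sides, and the product of the side masses does
    not depend on their order. *)
Lemma independent_law_permute n (W : probability Y R) (s : 'S_n) A :
  measurable A ->
  distribution (independent_law (fun _ : 'I_n => W)) (permute s) A =
  independent_law (fun _ : 'I_n => W) A.
Proof.
move: A; apply: box_unique => B mB.
transitivity (independent_law (fun _ : 'I_n => W)
    (permute s @^-1` box B)) => //.
rewrite (_ : _ @^-1` _ = box (fun j => B (s^-1%g j))); last first.
  apply/seteqP; split => t /= Bt i.
    by have := Bt (s^-1%g i); rewrite tnth_permute permKV.
  by have := Bt (s i); rewrite tnth_permute permK.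
rewrite !independent_law_box// (reindex_inj (@perm_inj _ s)) /=.
by apply: eq_bigr => i _; rewrite permK.
Qed.

Lemma ge0_integral_permute n (W : probability Y R) (s : 'S_n)
    (f : n.-tuple Y -> \bar R) :
  measurable_fun setT f -> (forall t, 0 <= f t) ->
  \int[independent_law (fun _ : 'I_n => W)]_t f (permute s t) =
  \int[independent_law (fun _ : 'I_n => W)]_t f t.
Proof.
move=> mf f0; transitivity
    (\int[distribution (independent_law (fun _ : 'I_n => W)) (permute s)]_t f t).
  by rewrite ge0_integral_distribution.
by apply: eq_measure_integral => A mA _; exact: independent_law_permute.
Qed.

Lemma measurable_prod_tnth n (q : 'I_n -> Y -> R) :
  (forall i, measurable_fun setT (q i)) ->
  measurable_fun setT (fun t : n.-tuple Y => \prod_(i < n) q i (tnth t i))%R.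
Proof.
move=> mq; apply: measurable_prod => i _.
by apply: (measurableT_comp (mq i)); exact: measurable_tnth.
Qed.

Lemma measurable_sum_tnth n (q : 'I_n -> Y -> R) :
  (forall i, measurable_fun setT (q i)) ->
  measurable_fun setT (fun t : n.-tuple Y => \sum_(i < n) q i (tnth t i))%R.
Proof.
move=> mq; apply: measurable_sum => i.
by apply: (measurableT_comp (mq i)); exact: measurable_tnth.
Qed.

(** Induction on [n]: Tonelli isolates the first coordinate, where [ge0_integral_density] changes
    [P ord0] into [W]; the remaining coordinates are handled by the induction hypothesis. *)
Lemma ge0_integral_independent_law_density n (W : probability Y R)
    (P : 'I_n -> probability Y R) (q : 'I_n -> Y -> R)
    (f : n.-tuple Y -> \bar R) :
  (forall i, measurable_fun setT (q i)) -> (forall i y, (0 <= q i y)%R) ->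
  (forall i A, measurable A -> P i A = \int[W]_(y in A) (q i y)%:E) ->
  measurable_fun setT f -> (forall t, 0 <= f t) ->
  \int[independent_law P]_t f t =
  \int[independent_law (fun _ : 'I_n => W)]_t
    (f t * (\prod_(i < n) q i (tnth t i))%:E).
Proof.
elim: n P q f => [|n IH] P q f mq q0 PE mf f0.
  by apply: eq_integral => t _; rewrite big_ord0 mule1.
have mfq : measurable_fun setT
    (fun t : n.+1.-tuple Y => f t * (\prod_(i < n.+1) q i (tnth t i))%:E).
  apply: emeasurable_funM => //; apply/measurable_EFinP.
  exact: measurable_prod_tnth.
rewrite ge0_integral_independent_lawS//.
rewrite [RHS]ge0_integral_independent_lawS//; last first.
  by move=> t; rewrite mule_ge0// lee_fin prodr_ge0.
rewrite (ge0_integral_density (mq ord0) (q0 ord0) (PE ord0)); last 2 first.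
- exact: measurable_ge0_integral_cons.
- by move=> y; exact: integral_ge0.
apply: eq_integral => y _.
have mfc : measurable_fun setT (fun t : n.-tuple Y => f (cons_pair (y, t))).
  by apply: measurableT_comp => //; apply: (@measurable_cons _ _ _ _ (cst y) _ id).
have mqc : measurable_fun setT
    (fun t : n.-tuple Y => (\prod_(i < n) q (lift ord0 i) (tnth t i))%:E).
  apply/measurable_EFinP.
  exact: (@measurable_prod_tnth n (fun i => q (lift ord0 i))).
rewrite (IH _ (fun i => q (lift ord0 i)))//; last by move=> i; exact: PE.
rewrite muleC -ge0_integralZl//; last 3 first.
- exact: emeasurable_funM.
- by move=> t _; rewrite mule_ge0// lee_fin prodr_ge0.
- by rewrite lee_fin.
apply: eq_integral => t _.
rewrite big_ord_recl tnth0 EFinM muleCA; congr (_ * (_ * (_)%:E)).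
by apply: eq_bigr => i _; rewrite tnthS.
Qed.

Lemma independent_law_density n (W : probability Y R)
    (P : 'I_n -> probability Y R) (q : 'I_n -> Y -> R) A :
  (forall i, measurable_fun setT (q i)) -> (forall i y, (0 <= q i y)%R) ->
  (forall i A, measurable A -> P i A = \int[W]_(y in A) (q i y)%:E) ->
  measurable A ->
  independent_law P A = \int[independent_law (fun _ : 'I_n => W)]_t
    ((\1_A t)%:E * (\prod_(i < n) q i (tnth t i))%:E).
Proof.
move=> mq q0 PE mA; rewrite -[A in LHS]setIT -integral_indic//.
rewrite (ge0_integral_independent_law_density mq q0 PE)//.
exact/measurable_EFinP.
Qed.

End independent_law_theory.

(** * Recurrences for binomial weights *)

Lemma binomial_pmf00 (R : realType) (p : R) : binomial_pmf 0 p 0 = 1.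
Proof. by rewrite /binomial_pmf subnn !expr0 mul1r bin0. Qed.

Lemma binomial_pmf_small (R : realType) n (p : R) m :
  (n < m)%N -> binomial_pmf n p m = 0.
Proof. by move=> nm; rewrite /binomial_pmf bin_small. Qed.

Lemma binomial_pmfS0 (R : realType) n (p : R) :
  binomial_pmf n.+1 p 0 = (1 - p) * binomial_pmf n p 0.
Proof. by rewrite /binomial_pmf !bin0 !expr0 !mulr1n !mul1r !subn0 exprS. Qed.

Lemma binomial_pmfSS (R : realType) n (p : R) m :
  binomial_pmf n.+1 p m.+1 =
  (1 - p) * binomial_pmf n p m.+1 + p * binomial_pmf n p m.
Proof.
rewrite /binomial_pmf binS mulrnDr subSS !mulrnAr; congr (_ + _ *+ _).
  have [nm|mn] := leqP n m; first by rewrite bin_small// !mulr0n.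
  by rewrite mulrCA -exprS -subSn.
by rewrite mulrA -exprS.
Qed.

(** Conditioning on one of the n + 1 trials: a failure leaves the count unchanged, a success shifts
    it by one. *)
Lemma sum_binomial_pmfS (R : realType) n (p : R) (x : nat -> \bar R) :
  (0 <= p <= 1)%R -> (forall m, 0 <= x m)%E ->
  (\sum_(m < n.+2) (binomial_pmf n.+1 p m)%:E * x m =
   (1 - p)%:E * (\sum_(m < n.+1) (binomial_pmf n p m)%:E * x m) +
   p%:E * (\sum_(m < n.+1) (binomial_pmf n p m)%:E * x m.+1))%E.
Proof.
move=> p01 x0; have [p0 p1] := andP p01.
have pmf0 k m : (0 <= (binomial_pmf k p m)%:E)%E.
  by rewrite lee_fin binomial_pmf_ge0.
(* The extra term at n + 1 has weight zero; adding it gives this sum the range of the left-hand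
   side. *)
have -> : (\sum_(m < n.+1) (binomial_pmf n p m)%:E * x m =
           \sum_(m < n.+2) (binomial_pmf n p m)%:E * x m)%E.
  by rewrite [RHS]big_ord_recr/= binomial_pmf_small// mul0e adde0.
rewrite !ge0_sume_distrr; try by move=> m _; rewrite mule_ge0.
rewrite !(big_ord_recl n.+1) -addeA -big_split/=; congr (_ + _)%E.
  by rewrite binomial_pmfS0 EFinM muleA.
apply: eq_bigr => m _; rewrite /bump/= add1n binomial_pmfSS.
have q0 : 0 <= 1 - p by rewrite subr_ge0.
by rewrite EFinD ge0_muleDl ?EFinM ?muleA// mule_ge0// lee_fin.
Qed.

(** * Expectations of functions of i.i.d. sums *)

Section iid_sums.
Local Open Scope ereal_scope.
Context d (Y : measurableType d) (R : realType) (W : probability Y R).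
Variables (F : R -> R) (g : Y -> R).
Hypotheses (mF : measurable_fun setT F) (F0 : forall x, (0 <= F x)%R).
Hypothesis mg : measurable_fun setT g.

(** With [F] the positive part and [a = 0] this is psi_m for the summand [g]. The offset [a] stores
    the coordinates already fixed in inductions on the number of samples. *)
Definition iid_sum_integral m (a : R) : \bar R :=
  \int[independent_law (fun _ : 'I_m => W)]_t
    (F (a + \sum_(i < m) g (tnth t i)))%:E.

Lemma measurable_iid_sum m a : measurable_fun setT
  (fun t : m.-tuple Y => (F (a + \sum_(i < m) g (tnth t i)))%:E).
Proof.
apply/measurable_EFinP; apply: (measurableT_comp mF).
by apply: measurable_funD => //; exact: (@measurable_sum_tnth _ _ _ m (fun=> g)).
Qed.

Let iid_sum_integral_cons m a y : iid_sum_integral m (a + g y) =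
  \int[independent_law (fun _ : 'I_m => W)]_t
    (F (a + \sum_(i < m.+1) g (tnth (cons_pair (y, t)) i)))%:E.
Proof.
apply: eq_integral => t _; rewrite big_ord_recl tnth0 addrA.
by congr (F (_ + _))%:E; apply: eq_bigr => i _; rewrite tnthS.
Qed.

Lemma iid_sum_integral_ge0 m a : 0 <= iid_sum_integral m a.
Proof. by apply: integral_ge0 => t _; rewrite lee_fin. Qed.

Lemma measurable_iid_sum_integral m a :
  measurable_fun setT (fun y => iid_sum_integral m (a + g y)).
Proof.
under eq_fun do rewrite iid_sum_integral_cons.
apply: (@measurable_ge0_integral_cons _ _ _ _ _
  (fun t => (F (a + \sum_(i < m.+1) g (tnth t i)))%:E)) => [|t].
  exact: measurable_iid_sum.
by rewrite lee_fin.
Qed.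

Lemma iid_sum_integralS m a :
  iid_sum_integral m.+1 a = \int[W]_y iid_sum_integral m (a + g y).
Proof.
rewrite {1}/iid_sum_integral ge0_integral_independent_lawS//.
- by apply: eq_integral => y _; rewrite iid_sum_integral_cons.
- exact: measurable_iid_sum.
- by move=> t; rewrite lee_fin.
Qed.

(** Each coordinate enters either the argument of [F] or the product, never both. Integrating the
    first coordinate either moves [g y] into the offset or, by independence, extracts a factor
    [c]. *)
Lemma integral_partial_sum n (b : 'I_n -> bool) (l : 'I_n -> Y -> R) (c a : R) :
  (0 <= c)%R ->
  (forall i, measurable_fun setT (l i)) -> (forall i y, (0 <= l i y)%R) ->
  (forall i, ~~ b i -> \int[W]_y (l i y)%:E = c%:E) ->
  \int[independent_law (fun _ : 'I_n => W)]_t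
    (F (a + \sum_(i < n) (if b i then g (tnth t i) else 0)) *
     \prod_(i < n) (if b i then 1 else l i (tnth t i)))%:E =
  (c ^+ \sum_(i < n) ~~ b i)%:E * iid_sum_integral (\sum_(i < n) b i) a.
Proof.
move=> c0; elim: n b l a => [|n IH] b l a ml l0 lE.
  rewrite !big_ord0 expr0 mul1e; apply: eq_integral => t _.
  by rewrite !big_ord0 mulr1.
pose b' (i : 'I_n) := b (lift ord0 i); pose l' (i : 'I_n) := l (lift ord0 i).
have mI k (bk : 'I_k -> bool) (lk : 'I_k -> Y -> R) a' :
    (forall i, measurable_fun setT (lk i)) ->
    measurable_fun setT (fun t : k.-tuple Y =>
    (F (a' + \sum_(i < k) (if bk i then g (tnth t i) else 0)) *
     \prod_(i < k) (if bk i then 1 else lk i (tnth t i)))%:E).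
  move=> mlk; apply/measurable_EFinP; apply: measurable_funM.
    apply: (measurableT_comp mF); apply: measurable_funD => //.
    apply: (@measurable_sum_tnth _ _ _ k (fun i y => if bk i then g y else 0%R)).
    by move=> i; case: (bk i).
  apply: (@measurable_prod_tnth _ _ _ k (fun i y => if bk i then 1 else lk i y)%R).
  by move=> i; case: (bk i).
have I0 k (bk : 'I_k -> bool) (lk : 'I_k -> Y -> R) a' t :
    (forall i y, (0 <= lk i y)%R) ->
    0 <= (F (a' + \sum_(i < k) (if bk i then g (tnth t i) else 0)) *
     \prod_(i < k) (if bk i then 1 else lk i (tnth t i)))%:E.
  by move=> lk0; rewrite lee_fin mulr_ge0// prodr_ge0// => i _; case: ifP.
rewrite ge0_integral_independent_lawS//; [|exact: mI|by move=> t; exact: I0].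
rewrite !(big_ord_recl n).
have IHy y : \int[independent_law (fun _ : 'I_n => W)]_t
    (F (a + \sum_(i < n.+1) (if b i then g (tnth (cons_pair (y, t)) i) else 0)) *
     \prod_(i < n.+1) (if b i then 1 else l i (tnth (cons_pair (y, t)) i)))%:E
    = (if b ord0 then 1 else l ord0 y)%:E *
      ((c ^+ (\sum_(i < n) ~~ b' i))%:E * iid_sum_integral (\sum_(i < n) b' i)
         (a + (if b ord0 then g y else 0%R))%R).
  rewrite -(IH b' l'); [|by move=> i; exact: ml|by move=> i; exact: l0
                        |by move=> i; exact: lE].
  rewrite -ge0_integralZl//.
  - apply: eq_integral => t _; rewrite -EFinM; congr _%:E.
    rewrite !(big_ord_recl n) tnth0 addrA mulrCA.
    by congr (_ * (F (_ + _) * _))%R; apply: eq_bigr => i _; rewrite tnthS.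
  - by apply: mI => i; exact: ml.
  - by move=> t _; apply: I0 => i; exact: l0.
  - by rewrite lee_fin; case: ifP.
under eq_integral do rewrite IHy.
have c'0 : (0 <= c ^+ (\sum_(i < n) ~~ b' i))%R by rewrite exprn_ge0.
case: (boolP (b ord0)) => b0 /=.
  under eq_integral do rewrite mul1e.
  rewrite add0n iid_sum_integralS ge0_integralZl//.
  - exact: measurable_iid_sum_integral.
  - by move=> y _; exact: iid_sum_integral_ge0.
under eq_integral do rewrite addr0.
rewrite ge0_integralZr//.
- by rewrite lE// exprS EFinM muleA.
- exact/measurable_EFinP.
- by move=> y _; rewrite lee_fin.
- by rewrite mule_ge0 ?lee_fin// iid_sum_integral_ge0.
Qed.

(** Each summand is 0 with probability 1 - p and a sample of [g] under [W] otherwise, so the number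
    of genuine samples is binomial. The proof integrates the first summand and applies
    [sum_binomial_pmfS]. *)
Lemma integral_sum_mixture n (Q : 'I_n -> probability R R) (p a : R) :
  (0 <= p <= 1)%R ->
  (forall i (H : R -> \bar R), measurable_fun setT H -> (forall u, 0 <= H u) ->
     \int[Q i]_u H u = (1 - p)%:E * H 0%R + p%:E * \int[W]_y H (g y)) ->
  \int[independent_law Q]_u (F (a + \sum_(i < n) tnth u i))%:E =
  \sum_(m < n.+1) (binomial_pmf n p m)%:E * iid_sum_integral m a.
Proof.
move=> /andP[p0 p1]; elim: n Q a => [|n IH] Q a QE.
  rewrite big_ord_recl big_ord0 adde0 binomial_pmf00 mul1e.
  rewrite /iid_sum_integral; under eq_integral do rewrite big_ord0.
  under [RHS]eq_integral do rewrite big_ord0.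
  by rewrite !integral_cst// !probability_setT.
have mH : measurable_fun setT
    (fun u : n.+1.-tuple R => (F (a + \sum_(i < n.+1) tnth u i))%:E).
  apply/measurable_EFinP/(measurableT_comp mF); apply: measurable_funD => //.
  by apply: (@measurable_sum_tnth _ _ _ n.+1 (fun=> id)) => i.
have H0 (u : n.+1.-tuple R) : 0 <= (F (a + \sum_(i < n.+1) tnth u i))%:E.
  by rewrite lee_fin.
rewrite ge0_integral_independent_lawS//.
pose H u := \sum_(m < n.+1) (binomial_pmf n p m)%:E * iid_sum_integral m (a + u).
have pmf0 k m : (0 <= (binomial_pmf k p m)%:E)%E.
  by rewrite lee_fin binomial_pmf_ge0// p0.
have HE u : \int[independent_law (fun i : 'I_n => Q (lift ord0 i))]_t
    (F (a + \sum_(i < n.+1) tnth (cons_pair (u, t)) i))%:E = H u.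
  rewrite /H -(IH (fun i => Q (lift ord0 i))) => [|i K mK K0]; last exact: QE.
  apply: eq_integral => t _; rewrite big_ord_recl tnth0 addrA.
  by congr (F (_ + _))%:E; apply: eq_bigr => i _; rewrite tnthS.
under eq_integral do rewrite HE.
rewrite QE; last 2 first.
- rewrite -(_ : (fun u => \int[independent_law (fun i : 'I_n => Q (lift ord0 i))]_t
    (F (a + \sum_(i < n.+1) tnth (cons_pair (u, t)) i))%:E) = H); last first.
    exact/funext.
  apply: (@measurable_ge0_integral_cons _ _ _ _
    (independent_law (fun i : 'I_n => Q (lift ord0 i)))
    (fun t => (F (a + \sum_(i < n.+1) tnth t i))%:E)); [exact: mH|exact: H0].
- by move=> u; rewrite /H; apply: sume_ge0 => m _; rewrite mule_ge0// iid_sum_integral_ge0.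
rewrite (@sum_binomial_pmfS _ n p (iid_sum_integral^~ a)) ?p0//; last first.
  by move=> m; exact: iid_sum_integral_ge0.
rewrite /H addr0; congr (_ + _ * _).
rewrite ge0_integral_sum//.
- apply: eq_bigr => m _; rewrite iid_sum_integralS ge0_integralZl//.
  + exact: measurable_iid_sum_integral.
  + by move=> y _; exact: iid_sum_integral_ge0.
- by move=> m; apply/measurable_funeM/measurable_iid_sum_integral.
- by move=> m y _; rewrite mule_ge0// iid_sum_integral_ge0.
Qed.

End iid_sums.

(** * Densities of the local randomizer relative to the blanket *)

Section blanket_theory.
Local Open Scope ereal_scope.
Context (R : realType) (X : Type) d (Y : measurableType d).
Variables (mu : {measure set Y -> \bar R}) (r : X -> Y -> R) (eps0 : R).
Hypotheses (hr : local_randomizer mu r) (hLDP : LDP r eps0).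

Local Notation W := (blanket_law mu r).
Local Notation omega := (blanket_density mu r).
Local Notation gamma := (blanket_mass mu r).

Lemma pdf_lawE (f : Y -> R) A : is_pdf mu f ->
  pdf_law mu f A = \int[mu]_(y in A) (f y)%:E.
Proof. by move=> pf; rewrite /pdf_law asboolT. Qed.

Lemma density_ge0 x y : (0 <= r x y)%R.
Proof. by have [/(_ x)[]] := hr. Qed.

Lemma measurable_density x : measurable_fun setT (r x).
Proof. by have [/(_ x)[]] := hr. Qed.

Lemma inf_density_le x y : (inf_density r y <= r x y)%R.
Proof.
apply: ge_inf; last by exists x.
by exists 0%R => _ [x' _ <-]; exact: density_ge0.
Qed.

(** By LDP, [expR (- eps0) * r x y] is a lower bound of all densities at [y], hence of their
    infimum. This makes every output law absolutely continuous with respect to the blanket. *)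
Lemma inf_density_eq0 x y :
  (inf_density r y = 0 -> r x y = 0)%R.
Proof.
move=> h0; apply/eqP; rewrite eq_le density_ge0 andbT leNgt; apply/negP => r0.
suff : (expR (- eps0) * r x y <= inf_density r y)%R.
  by rewrite h0 leNgt mulr_gt0// expR_gt0.
apply: lb_le_inf; first by exists (r x y); exists x.
move=> _ [x'' _ <-]; rewrite expRN mulrC ler_pdivrMr ?expR_gt0// mulrC.
exact: hLDP.
Qed.

Variable x0 : X.

(** For an empty [X] the infimum takes its default value 0 and the mass vanishes; the witness [x0]
    excludes this. *)
Lemma blanket_mass_gt0 : (0 < gamma)%R.
Proof. by have [/andP[]] := blanket_pdf x0 hr hLDP. Qed.

Lemma blanket_mass_le1 : (gamma <= 1)%R.
Proof. by have [/andP[]] := blanket_pdf x0 hr hLDP. Qed.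

Lemma blanket_is_pdf : is_pdf mu omega.
Proof. by have [] := blanket_pdf x0 hr hLDP. Qed.

Lemma measurable_blanket_density : measurable_fun setT omega.
Proof. by have [] := blanket_is_pdf. Qed.

Lemma blanket_density_eq0 x y : (omega y = 0 -> r x y = 0)%R.
Proof.
move=> /eqP; rewrite mulf_eq0 invr_eq0 (gt_eqF blanket_mass_gt0) orbF => /eqP.
exact: inf_density_eq0.
Qed.

(** Stated for any [q] because two versions of the same density are needed: the plain ratio, and the
    sum of [gamma] and a nonnegative remainder. *)
Lemma output_law_blanketE x (q : Y -> R) A :
  measurable_fun setT q -> (forall y, (0 <= q y)%R) ->
  (forall y, q y * omega y = r x y)%R -> measurable A ->
  output_law mu r x A = \int[W]_(y in A) (q y)%:E.
Proof.
move=> mq q0 qE mA; have [momega omega0 _] := blanket_is_pdf.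
rewrite [LHS]pdf_lawE; last by have [] := hr.
rewrite [RHS]integral_mkcond.
rewrite (@ge0_integral_density _ _ _ mu W _ momega omega0); last 3 first.
- by move=> B mB; rewrite [LHS]pdf_lawE//; exact: blanket_is_pdf.
- apply: (measurable_restrictT _ _).1 => //.
  by apply: measurable_funTS; exact/measurable_EFinP.
- by move=> y; rewrite erestrict_ge0// => z _; rewrite lee_fin.
rewrite integral_mkcond; apply: eq_integral => y _.
by rewrite !patchE; case: ifP; rewrite ?mul0e// -EFinM qE.
Qed.

(** The density p_x of R(x) with respect to the blanket, with value 0 where [omega] vanishes. *)
Definition blanket_ratio x y : R := (r x y / omega y)%R.

Lemma measurable_blanket_ratio x : measurable_fun setT (blanket_ratio x).
Proof.
apply: measurable_funM; first exact: measurable_density.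
(* The inverse agrees with the real power of exponent -1 because [omega] is nonnegative;
   measurability of real powers then applies. *)
rewrite (_ : (fun _ => _) = fun y => (omega y `^ (-1))%R); last first.
  apply/funext => y; rewrite powR_inv1//.
  by have [_ /(_ y)] := blanket_is_pdf.
exact: (measurableT_comp (measurable_powR (-1)) measurable_blanket_density).
Qed.

Lemma blanket_ratio_ge0 x y : (0 <= blanket_ratio x y)%R.
Proof.
rewrite /blanket_ratio divr_ge0// ?density_ge0//.
by have [_ /(_ y)] := blanket_is_pdf.
Qed.

Lemma blanket_ratioK x y : (blanket_ratio x y * omega y = r x y)%R.
Proof.
rewrite /blanket_ratio; have [w0|w0] := eqVneq (omega y) 0%R.
  by rewrite w0 mulr0 blanket_density_eq0.
by rewrite divfK.
Qed.

Lemma output_law_ratio x A : measurable A ->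
  output_law mu r x A = \int[W]_(y in A) (blanket_ratio x y)%:E.
Proof.
apply: output_law_blanketE; [exact: measurable_blanket_ratio|
  exact: blanket_ratio_ge0|exact: blanket_ratioK].
Qed.

(* Where omega y = 0 the junk value blanket_ratio x y = 0 is below gamma; the
   value 0 keeps [leftover] nonnegative and still makes [gamma + leftover x] a
   version of the density of R(x) with respect to the blanket. *)
Definition leftover x y : R :=
  if omega y == 0%R then 0%R else (blanket_ratio x y - gamma)%R.

Lemma measurable_leftover x : measurable_fun setT (leftover x).
Proof.
apply: measurable_fun_ifT => //.
- by apply: measurable_fun_eqr => //; exact: measurable_blanket_density.
- by apply: measurable_funB => //; exact: measurable_blanket_ratio.
Qed.

(** Where [omega y] is positive, [gamma * omega y] is the infimum of the densities, so the ratio is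
    at least [gamma]. *)
Lemma leftover_ge0 x y : (0 <= leftover x y)%R.
Proof.
rewrite /leftover; case: eqP => // /eqP w0; rewrite subr_ge0.
have wgt0 : (0 < omega y)%R.
  by have [_ /(_ y) wy _] := blanket_is_pdf; rewrite lt_neqAle eq_sym w0.
rewrite ler_pdivlMr// mulrC divfK ?gt_eqF ?blanket_mass_gt0//.
exact: inf_density_le.
Qed.

Lemma output_law_leftover x A : measurable A ->
  output_law mu r x A = \int[W]_(y in A) (gamma + leftover x y)%:E.
Proof.
apply: output_law_blanketE.
- by apply: measurable_funD => //; exact: measurable_leftover.
- by move=> y; rewrite addr_ge0 ?leftover_ge0// ltW// blanket_mass_gt0.
- move=> y; rewrite /leftover; case: eqP => [w0|_].
    by rewrite w0 mulr0 blanket_density_eq0.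
  by rewrite subrKC blanket_ratioK.
Qed.

(** R(x) has total mass 1, of which the constant part of its density accounts for [gamma]. *)
Lemma integral_leftover x : \int[W]_y (leftover x y)%:E = (1 - gamma)%:E.
Proof.
have := probability_setT (output_law mu r x).
rewrite (output_law_leftover x measurableT).
under eq_integral do rewrite EFinD.
have mlE : measurable_fun setT (fun y => (leftover x y)%:E).
  by apply/measurable_EFinP; exact: measurable_leftover.
rewrite ge0_integralD//; last 2 first.
- by move=> y _; rewrite lee_fin ltW// blanket_mass_gt0.
- by move=> y _; rewrite lee_fin leftover_ge0.
rewrite integral_cst// [X in _ * X]probability_setT mule1 => H.
by rewrite EFinB -H addeAC subee// add0e.
Qed.

End blanket_theory.

(** * The expected positive part of a sum of GPARV copies *)

Section gparv_expectation.
Local Open Scope ereal_scope.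
Context (R : realType) (X : Type) d (Y : measurableType d).
Variables (mu : {measure set Y -> \bar R}) (r : X -> Y -> R) (eps0 : R).
Hypotheses (hr : local_randomizer mu r) (hLDP : LDP r eps0).
Variables (eps : R) (x x' : X).

Local Notation W := (blanket_law mu r).
Local Notation gamma := (blanket_mass mu r).

Lemma PARVE y : PARV mu r eps x x' y =
  (blanket_ratio mu r x y - expR eps * blanket_ratio mu r x' y)%R.
Proof. by rewrite /PARV mulrBl mulrA. Qed.

Lemma measurable_PARV : measurable_fun setT (PARV mu r eps x x').
Proof.
rewrite (funext PARVE).
apply: measurable_funB; first exact: (measurable_blanket_ratio hr hLDP x).
by apply: measurable_funM => //; exact: (measurable_blanket_ratio hr hLDP x).
Qed.

Lemma measurable_GPARV : measurable_fun setT (GPARV mu r eps x x').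
Proof.
apply: (@measurable_fun_if_pair _ _ _ _
  (fun y => gamma^-1 * PARV mu r eps x x' y)%R (cst 0%R)) => //.
by apply: measurable_funM => //; exact: measurable_PARV.
Qed.

Let gparv_mixin := isMeasurableFun.Build _ _ _ _ _ measurable_GPARV.
Let gparv : {mfun (Y * bool)%type >-> R} := HB.pack (GPARV mu r eps x x') gparv_mixin.

(** Tonelli followed by a split on the Bernoulli coordinate; this is the mixture hypothesis of
    [integral_sum_mixture] with [p = gamma]. *)
Lemma ge0_integral_GPARV (Q : probability R R) (H : R -> \bar R) :
  (forall A, measurable A -> Q A = GPARV_law mu r eps x x' A) ->
  measurable_fun setT H -> (forall u, 0 <= H u) ->
  \int[Q]_u H u = (1 - gamma)%:E * H 0%R +
    gamma%:E * \int[W]_y H (gamma^-1 * PARV mu r eps x x' y)%R.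
Proof.
move=> QE mH H0.
have g01 : (0 <= gamma <= 1)%R.
  by rewrite ltW ?(blanket_mass_gt0 hr hLDP x)// (blanket_mass_le1 hr hLDP x).
rewrite (_ : \int[Q]_u H u =
    \int[distribution (W \x bernoulli_prob gamma) gparv]_u H u); last first.
  by apply: eq_measure_integral => A mA _; exact: QE.
rewrite ge0_integral_distribution//.
have mHG : measurable_fun setT (H \o gparv).
  exact: measurableT_comp measurable_GPARV.
rewrite fubini_tonelli1//=.
have mHg : measurable_fun setT
    (fun y => H (gamma^-1 * PARV mu r eps x x' y)%R).
  apply: measurableT_comp => //.
  by apply: measurable_funM => //; exact: measurable_PARV.
rewrite /fubini_F; under eq_integral do rewrite integral_bernoulli_prob//=.
have g0 : 0 <= gamma%:E by rewrite lee_fin; case/andP: g01.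
have g1 : 0 <= (1 - gamma)%:E by rewrite lee_fin subr_ge0; case/andP: g01.
rewrite /GPARV/= ge0_integralD//.
- rewrite addeC integral_cst// [X in _ * X]probability_setT mule1.
  by congr (_ + _); rewrite ge0_integralZl.
- by move=> y _; rewrite mule_ge0.
- exact: measurable_funeM.
- by move=> y _; rewrite mule_ge0.
Qed.

(** By [box_unique] it suffices to compare the two laws on boxes, where mutual independence yields
    the product. *)
Lemma iid_copies_tuple d' (O : measurableType d') (P : probability O R)
    (G : nat -> {RV P >-> R}) (law : set R -> \bar R) n
    (f : n.-tuple R -> \bar R) :
  iid_copies G law -> measurable_fun setT f -> (forall t, 0 <= f t) ->
  \int[P]_w f [tuple G i w | i < n] =
  \int[independent_law (fun i : 'I_n => distribution P (G i))]_t f t.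
Proof.
move=> [indep _] mf f0.
have mG : measurable_fun setT (fun w => [tuple G i w | i < n]).
  apply/measurable_fun_tnthP => i.
  rewrite (_ : _ \o _ = G i); first exact: measurable_funPT.
  by apply/funext => w /=; rewrite tnth_mktuple.
pose Gm := isMeasurableFun.Build _ _ _ _ _ mG.
pose Gt : {mfun O >-> n.-tuple R} := HB.pack (fun w => [tuple G i w | i < n]) Gm.
transitivity (\int[distribution P Gt]_t f t).
  by rewrite ge0_integral_distribution.
apply: eq_measure_integral => A mA _; move: A mA; apply: box_unique => B mB.
rewrite independent_law_box//.
(* Independence is stated for families over all of [nat], so [B] is padded with [setT]; [J] selects
   the first n indices. *)
pose B' i := if insub i is Some j then B j else setT.
have mB' i : measurable (B' i) by rewrite /B'; case: insubP.
have B'E (i : 'I_n) : B' i = B i by rewrite /B' valK.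
pose J := [fset i | i in iota 0 n]%fset.
have JE : perm_eq (enum_fset J) (iota 0 n).
  apply: uniq_perm; rewrite ?fset_uniq ?iota_uniq// => i.
  by apply/imfsetP/idP => [[j jn ->]//|jn]; exists i.
transitivity (P (\bigcap_(i in [set` J]) (G i @^-1` B' i))).
  rewrite /distribution /pushforward/=; congr (P _).
  apply/seteqP; split => w /= Bw i.
    rewrite /= -[i \in _]/(i \in enum_fset J) (perm_mem JE) mem_iota => /andP[_ ni].
    rewrite /B'; case: insubP => // j _ ij.
    by have := Bw j; rewrite tnth_mktuple ij.
  rewrite tnth_mktuple -B'E; apply: Bw.
  by rewrite /= -[_ \in _]/(_ \in enum_fset J) (perm_mem JE) mem_iota /= add0n.
rewrite indep// (perm_big _ JE)/=.
have -> : iota 0 n = index_iota 0 n by rewrite /index_iota subn0.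
by rewrite big_mkord; apply: eq_bigr => i _; rewrite B'E.
Qed.

Lemma expectation_sum_GPARV d' (O : measurableType d') (P : probability O R)
    (G : nat -> {RV P >-> R}) n :
  iid_copies G (GPARV_law mu r eps x x') ->
  'E_P[fun w => (Num.max 0 (\sum_(i < n) G i w))%R] =
  \sum_(m < n.+1) (binomial_pmf n gamma m)%:E *
    (gamma^-1%:E * iid_sum_integral W (Num.max (0 : R))%R (PARV mu r eps x x') m 0).
Proof.
move=> GE.
have g0 : (0 < gamma)%R by exact: (blanket_mass_gt0 hr hLDP x).
have mmax : measurable_fun setT (Num.max (0 : R))%R.
  exact: measurable_maxr.
have max0 u : (0 <= Num.max (0 : R) u)%R by rewrite le_max lexx.
have mf : measurable_fun setT
    (fun u : n.-tuple R => (Num.max 0 (0 + \sum_(i < n) tnth u i))%:E)%R.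
  apply/measurable_EFinP/(measurableT_comp mmax)/measurable_funD => //.
  by apply: (@measurable_sum_tnth _ _ _ n (fun=> id)) => i.
transitivity (\int[P]_w
    (Num.max 0 (0 + \sum_(i < n) tnth [tuple G i w | i < n] i))%R%:E).
  rewrite unlock; apply: eq_integral => w _; rewrite add0r.
  by congr (Num.max _ _)%:E; apply: eq_bigr => i _; rewrite tnth_mktuple.
rewrite (iid_copies_tuple GE mf); last by move=> t; rewrite lee_fin.
have mgP : measurable_fun setT (fun y => gamma^-1 * PARV mu r eps x x' y)%R.
  by apply: measurable_funM => //; exact: measurable_PARV.
rewrite (integral_sum_mixture (W := W) mmax max0 mgP (p := gamma)); last 2 first.
- by rewrite ltW//= (blanket_mass_le1 hr hLDP x).
- by move=> i H mH H0; apply: ge0_integral_GPARV => // A mA; exact: GE.2.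
apply: eq_bigr => m _; congr (_ * _).
(* The positive factor 1 / gamma of every nonzero copy leaves the sum, then the maximum, then the
   integral. *)
rewrite /iid_sum_integral -ge0_integralZl//.
- apply: eq_integral => t _; rewrite -EFinM !add0r -mulr_sumr.
  by rewrite maxr_pMr ?mulr0// invr_ge0 ltW.
- exact: (measurable_iid_sum mmax measurable_PARV).
- by move=> t _; rewrite lee_fin.
- by rewrite lee_fin invr_ge0 ltW.
Qed.

End gparv_expectation.

(** * Averaging over the coordinates of an i.i.d. tuple *)

Lemma ge0_sume_const (R : realType) (I : finType) (A : {pred I}) (c : \bar R) :
  (0 <= c -> \sum_(i in A) c = (#|A|%:R)%:E * c)%E.
Proof.
move=> c0; rewrite -sum1_card natr_sum -sumEFin ge0_sume_distrl//.
by apply: eq_bigr => i _; rewrite mul1e.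
Qed.

(** The i.i.d. law and [f] are both invariant under the transposition of 0 and i, so every
    coordinate gives the same integral as coordinate 0 and can be replaced by the mean. *)
Lemma ge0_integral_symmetric d (Y : measurableType d) (R : realType)
    (W : probability Y R) n (f : n.+1.-tuple Y -> \bar R) (p : Y -> R) :
  measurable_fun setT f -> (forall t, 0 <= f t)%E ->
  (forall s t, f (permute s t) = f t) ->
  measurable_fun setT p -> (forall y, 0 <= p y) ->
  (\int[independent_law (fun _ : 'I_n.+1 => W)]_t (f t * (p (tnth t ord0))%:E) =
   \int[independent_law (fun _ : 'I_n.+1 => W)]_t
     (f t * (n.+1%:R^-1 * \sum_(i < n.+1) p (tnth t i))%:E))%E.
Proof.
move=> mf f0 fs mp p0.
have mfp i : measurable_fun setT (fun t : n.+1.-tuple Y => f t * (p (tnth t i))%:E)%E.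
  apply: emeasurable_funM => //; apply/measurable_EFinP.
  by apply: (measurableT_comp mp); exact: measurable_tnth.
have fp0 i t : (0 <= f t * (p (tnth t i))%:E)%E by rewrite mule_ge0 ?lee_fin.
under [RHS]eq_integral => t _.
  rewrite EFinM muleCA -sumEFin ge0_sume_distrr; last first.
    by move=> i _; rewrite lee_fin.
  over.
rewrite ge0_integralZl//; last 2 first.
- exact: emeasurable_sum.
- by move=> t _; exact: sume_ge0.
rewrite ge0_integral_sum//.
under eq_bigr => i _.
  rewrite -(ge0_integral_permute W (tperm ord0 i))//.
  under eq_integral do rewrite fs tnth_permute tpermR.
  over.
rewrite ge0_sume_const ?integral_ge0// card_ord muleA -EFinM mulVf ?mul1e//.
Qed.

(** * The hockey-stick divergence of the blanket pair *)

Section blanket_pair_hockey_stick.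
Local Open Scope ereal_scope.
Context (R : realType) (X : Type) d (Y : measurableType d).
Variables (mu : {measure set Y -> \bar R}) (r : X -> Y -> R) (eps0 : R).
Hypotheses (hr : local_randomizer mu r) (hLDP : LDP r eps0).

Local Notation W := (blanket_law mu r).
Local Notation gamma := (blanket_mass mu r).

(** The mean of p_x over the samples. Reading the size from the multiset gives one function on all
    multisets, usable for every value of |b|. *)
Definition mset_ratio x (S : mset_of Y) : R :=
  let s := multiset.enum_mset S in ((size s)%:R^-1 * \sum_(y <- s) blanket_ratio mu r x y)%R.

Lemma mset_ratio_tuple x n (t : n.-tuple Y) : mset_ratio x (tuple_mset t) =
  (n%:R^-1 * \sum_(i < n) blanket_ratio mu r x (tnth t i))%R.
Proof.
have St : perm_eq (multiset.enum_mset (tuple_mset t)) t by exact: multiset.perm_eq_seq_mset.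
rewrite /mset_ratio (perm_size St) size_tuple (perm_big _ St)/=.
by rewrite big_tuple.
Qed.

(** For the quotient sigma-algebra, measurability is checked after composition with each
    [tuple_mset]. *)
Lemma measurable_mset_ratio x : measurable_fun setT (mset_ratio x).
Proof.
move=> _ B mB; rewrite setTI; change (mset_measurable (mset_ratio x @^-1` B)) => n.
rewrite -comp_preimage (_ : _ \o _ = fun t : n.-tuple Y =>
    (n%:R^-1 * \sum_(i < n) blanket_ratio mu r x (tnth t i))%R); last first.
  by apply/funext => t; exact: mset_ratio_tuple.
rewrite -[X in measurable X]setTI.
suff : measurable_fun setT (fun t : n.-tuple Y =>
    (n%:R^-1 * \sum_(i < n) blanket_ratio mu r x (tnth t i))%R) by apply.
apply: measurable_funM => //.
apply: (@measurable_sum_tnth _ _ _ n (fun=> blanket_ratio mu r x)) => _.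
exact: (measurable_blanket_ratio hr hLDP x).
Qed.

Lemma mset_ratio_ge0 x S : (0 <= mset_ratio x S)%R.
Proof.
rewrite /mset_ratio mulr_ge0// sumr_ge0// => y _.
exact: (blanket_ratio_ge0 hr hLDP x).
Qed.

Lemma tuple_mset_permute n (s : 'S_n) (t : n.-tuple Y) :
  tuple_mset (permute s t) = tuple_mset t.
Proof.
by apply/multiset.eq_seq_msetP/tuple_permP; exists s.
Qed.

(** On tuples the density is p_x at coordinate 0. Membership of the multiset in [A] is symmetric, so
    [ge0_integral_symmetric] spreads this factor over all coordinates. *)
Lemma blanket_mset_density x m A : measurable A ->
  blanket_mset mu r x m A =
  \int[independent_law (fun _ : 'I_m.+1 => W)]_t
    ((\1_A (tuple_mset t))%:E * (mset_ratio x (tuple_mset t))%:E).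
Proof.
move=> mA.
have mratio := measurable_blanket_ratio hr hLDP x x.
have ratio0 := blanket_ratio_ge0 hr hLDP x x.
have mA' : measurable (@tuple_mset _ Y m.+1 @^-1` A) by exact: mA.
pose q (i : 'I_m.+1) := if i == ord0 then blanket_ratio mu r x else cst 1%R.
transitivity (independent_law (fun i : 'I_m.+1 =>
    if i == ord0 then output_law mu r x else W) (@tuple_mset _ Y m.+1 @^-1` A)) => //.
rewrite (@independent_law_density _ _ _ _ W _ q)//; last 3 first.
- by move=> i; rewrite /q; case: ifP.
- by move=> i y; rewrite /q; case: ifP.
- move=> i B mB; rewrite /q; case: ifP => _; first exact: (output_law_ratio hr hLDP x).
  by rewrite (eq_integral (cst 1)) ?integral_cst// mul1e.
under [RHS]eq_integral do rewrite mset_ratio_tuple.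
rewrite -ge0_integral_symmetric//.
- apply: eq_integral => t _; rewrite big_ord_recl big1 ?mulr1//.
- apply/measurable_EFinP.
  by apply: (measurable_indic (D := setT) mA').
- by move=> s t; rewrite tuple_mset_permute.
Qed.

Lemma measurable_numbered_mset m :
  measurable_fun setT (fun t : m.+1.-tuple Y => (m, tuple_mset t)).
Proof.
by apply: measurable_fun_pair => //; exact: measurable_funPT.
Qed.


Let numbered_mset_mixin m :=
  isMeasurableFun.Build _ _ _ _ _ (@measurable_numbered_mset m).
Let numbered_mset m : {mfun m.+1.-tuple Y >-> (nat * mset_of Y)%type} :=
  HB.pack (fun t : m.+1.-tuple Y => (m, tuple_mset t)) (numbered_mset_mixin m).

Lemma hockey_stick_blanket_pair n eps (x x' : X) :
  hockey_stick (expR eps) (blanket_pair mu r n.+1 x) (blanket_pair mu r n.+1 x') =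
  \sum_(m < n.+1) (binomial_pmf n gamma m)%:E * (m.+1%:R^-1%:E *
    iid_sum_integral W (Num.max (0 : R))%R (PARV mu r eps x x') m.+1 0%R).
Proof.
have g0 : (0 <= gamma)%R by rewrite ltW// (blanket_mass_gt0 hr hLDP x).
have g1 : (gamma <= 1)%R by exact: (blanket_mass_le1 hr hLDP x).
pose Wm m := distribution (independent_law (fun _ : 'I_m.+1 => W)) (numbered_mset m).
(* A common reference measure: the law of the pair when all m + 1 samples come from the blanket. *)
pose nu := msum (fun m => mscale (@bin_prob R n gamma g0 g1 m) (Wm m)) n.+1.
have nuE (f : nat * mset_of Y -> \bar R) :
    measurable_fun setT f -> (forall z, 0 <= f z) ->
    \int[nu]_z f z = \sum_(m < n.+1) (binomial_pmf n gamma m)%:E *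
      \int[independent_law (fun _ : 'I_m.+1 => W)]_t f (nat_of_ord m, tuple_mset t).
  move=> mf f0; rewrite ge0_integral_measure_sum//; apply: eq_bigr => m _.
  by rewrite ge0_integral_mscale// ge0_integral_distribution.
pose q z (S : nat * mset_of Y) := (mset_ratio z S.2)%:E.
have mq z : measurable_fun setT (q z).
  apply/measurable_EFinP; apply: (measurableT_comp (measurable_mset_ratio z)).
  exact: measurable_snd.
have q0 z S : 0 <= q z S by rewrite lee_fin mset_ratio_ge0.
have PBE z A : measurable A ->
    blanket_pair mu r n.+1 z A = \int[nu]_(S in A) q z S.
  move=> mA; transitivity (\int[binomial_prob n gamma]_m
      blanket_mset mu r z m (xsection A m)) => //.
  rewrite (@integral_binomial R n gamma g0 g1)// integral_mkcond nuE; last 2 first.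
  - by apply: (measurable_restrictT _ _).1 => //; exact: measurable_funTS.
  - by move=> S; rewrite erestrict_ge0.
  apply: eq_bigr => m _; congr (_ * _).
  rewrite blanket_mset_density; last exact: measurable_xsection.
  by apply: eq_integral => t _; rewrite patch_indicE /q !indicE mem_xsection.
have iq z : nu.-integrable setT (q z).
  apply/integrableP; split => //.
  under eq_integral do rewrite gee0_abs//.
  by rewrite -PBE// probability_setT ltry.
rewrite (hockey_stickE _ (iq x) (iq x') (PBE x) (PBE x')) nuE; last 2 first.
- apply: measurable_maxe => //; apply: emeasurable_funB => //.
  exact: measurable_funeM.
- by move=> z; rewrite le_max lexx.
apply: eq_bigr => m _; congr (_ * _).
rewrite /iid_sum_integral -ge0_integralZl//.
(* The weighted difference of the two means is the mean of the PARV, and the positive factor 1 / (m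
   + 1) leaves the maximum. *)
- apply: eq_integral => t _; rewrite /q/= !mset_ratio_tuple -EFinM -EFinB -EFin_max.
  under [in RHS]eq_bigr do rewrite PARVE.
  by rewrite add0r sumrB -mulr_sumr maxr_pMr// mulr0 mulrBr [in RHS]mulrCA.
- apply: measurable_iid_sum; first exact: measurable_maxr.
  exact: (measurable_PARV hr hLDP).
- by move=> t _; rewrite lee_fin le_max lexx.
Qed.

End blanket_pair_hockey_stick.

(** * Expansion over the sets of users imitating the blanket *)

Section subset_expansion.
Variable R : realFieldType.

(* The distinguished user 0 together with the users of S, user j being the
   coordinate [lift ord0 j]. *)
Definition clone_set n (S : {set 'I_n}) (i : 'I_n.+1) : bool :=
  if unlift ord0 i is Some j then j \in S else true.

Lemma sum_clone_set n (S : {set 'I_n}) :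
  (\sum_(i < n.+1) clone_set S i)%N = #|S|.+1.
Proof.
rewrite big_ord_recl /clone_set unlift_none add1n -sum1_card [in RHS]big_mkcond; congr _.+1.
by apply: eq_bigr => i _; rewrite liftK; case: (i \in S).
Qed.

Lemma sum_clone_setC n (S : {set 'I_n}) :
  (\sum_(i < n.+1) ~~ clone_set S i)%N = (n - #|S|)%N.
Proof.
have -> : (n - #|S|)%N = #|~: S| by have := cardsC S; rewrite card_ord => nE; rewrite -[X in (X - _)%N]nE addKn.
rewrite big_ord_recl /clone_set unlift_none add0n -sum1_card [in RHS]big_mkcond.
by apply: eq_bigr => i _; rewrite liftK inE; case: (i \in S).
Qed.

(* Composing s with the transposition (0 i) turns s 0 into s i and does not
   affect the product over the complement of the clone set. *)
Lemma sum_perm_clone_set n (S : {set 'I_n}) (L : 'I_n.+1 -> R)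
    (T : 'I_n.+1 -> 'I_n.+1 -> R) :
  \sum_(s : 'S_n.+1) L (s ord0) *
    \prod_i (if clone_set S i then 1 else T i (s i)) =
  \sum_(s : 'S_n.+1) (#|S|.+1%:R^-1 *
    \sum_i (if clone_set S i then L (s i) else 0)) *
    \prod_i (if clone_set S i then 1 else T i (s i)).
Proof.
have swap i : clone_set S i ->
    \sum_(s : 'S_n.+1) L (s i) *
      \prod_k (if clone_set S k then 1 else T k (s k)) =
    \sum_(s : 'S_n.+1) L (s ord0) *
      \prod_k (if clone_set S k then 1 else T k (s k)).
  move=> Si; rewrite (reindex_inj (mulgI (tperm ord0 i))) /=.
  apply: eq_bigr => s _; rewrite permM tpermR; congr (_ * _).
  apply: eq_bigr => k _; case: ifPn => // Sk; rewrite permM tpermD//.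
    by apply: contraNneq Sk => <-; rewrite /clone_set unlift_none.
  by apply: contraNneq Sk => <-.
under [RHS]eq_bigr do rewrite -mulrA mulr_suml.
rewrite -mulr_sumr exchange_big /=.
under [in RHS]eq_bigr => i _.
  rewrite (_ : \sum_(s : 'S_n.+1) _ = (clone_set S i)%:R *
    \sum_(s : 'S_n.+1) L (s ord0) *
      \prod_k (if clone_set S k then 1 else T k (s k))); last first.
    case: (boolP (clone_set S i)) => Si; last by rewrite mul0r big1// => s _; rewrite mul0r.
    by rewrite mul1r -(swap i Si).
  over.
by rewrite -mulr_suml -natr_sum sum_clone_set mulKf// pnatr_eq0.
Qed.

(** The product is expanded over the set S of indices that contribute [c]; [sum_perm_clone_set] then
    turns [L (s ord0)] into a mean over the clone set. All other factors are nonnegative, so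
    sublinearity of the positive part bounds the sum term by term. *)
Lemma max0_sum_perm_le n (c : R) (L : 'I_n.+1 -> R) (l : 'I_n -> 'I_n.+1 -> R) :
  0 <= c -> (forall j k, 0 <= l j k) ->
  Num.max 0 (\sum_(s : 'S_n.+1)
    L (s ord0) * \prod_(j < n) (c + l j (s (lift ord0 j)))) <=
  \sum_(S : {set 'I_n}) c ^+ #|S| * #|S|.+1%:R^-1 * \sum_(s : 'S_n.+1)
    Num.max 0 (\sum_i (if clone_set S i then L (s i) else 0)) *
    \prod_i (if clone_set S i then 1
             else (if unlift ord0 i is Some j then l j (s i) else 0)).
Proof.
move=> c0 l0.
(* [T] extends [l] to index 0 by a default; index 0 lies in every clone set, where the products take
   the factor 1. *)
pose T i k : R := if unlift ord0 i is Some j then l j k else 0.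
have T0 i k : 0 <= T i k by rewrite /T; case: unliftP.
have prodT0 S (s : 'S_n.+1) : 0 <= \prod_i (if clone_set S i then 1 else T i (s i)).
  by apply: prodr_ge0 => i _; case: ifP.
have -> : \sum_(s : 'S_n.+1)
      L (s ord0) * \prod_(j < n) (c + l j (s (lift ord0 j))) =
    \sum_(S : {set 'I_n}) c ^+ #|S| * \sum_(s : 'S_n.+1)
      (#|S|.+1%:R^-1 * \sum_i (if clone_set S i then L (s i) else 0)) *
      \prod_i (if clone_set S i then 1 else T i (s i)).
  transitivity (\sum_(s : 'S_n.+1) \sum_(S : {set 'I_n}) c ^+ #|S| *
      (L (s ord0) * \prod_i (if clone_set S i then 1 else T i (s i)))).
    apply: eq_bigr => s _; rewrite bigA_distr mulr_sumr; apply: eq_bigr => S _.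
    rewrite mulrCA; congr (_ * _).
    rewrite big_ord_recl {1}/clone_set unlift_none mul1r.
    rewrite -prodr_const [X in X * _]big_mkcond -big_split/=.
    apply: eq_bigr => j _; rewrite /clone_set /T liftK.
    by case: (j \in S); rewrite ?mulr1 ?mul1r.
  rewrite exchange_big; apply: eq_bigr => S _.
  by rewrite -mulr_sumr sum_perm_clone_set.
rewrite ge_max; apply/andP; split.
  apply: sumr_ge0 => S _; rewrite mulr_ge0 ?mulr_ge0 ?exprn_ge0//.
  by apply: sumr_ge0 => s _; apply: mulr_ge0; [rewrite le_max lexx|exact: prodT0].
apply: ler_sum => S _; rewrite -mulrA ler_wpM2l ?exprn_ge0// mulr_sumr.
apply: ler_sum => s _; rewrite mulrA ler_wpM2r//.
by rewrite ler_wpM2l// le_max lexx orbT.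
Qed.

End subset_expansion.

(** The subsets are grouped by cardinality, with C(n, m) of them in class m. *)
Lemma sum_subsets_binomial (R : realType) n (p : R) (x : nat -> \bar R) :
  0 <= p <= 1 -> (forall m, 0 <= x m)%E ->
  (\sum_(S : {set 'I_n}) (p ^+ #|S| * (1 - p) ^+ (n - #|S|))%:E * x #|S| =
   \sum_(m < n.+1) (binomial_pmf n p m)%:E * x m)%E.
Proof.
move=> /andP[p0 p1] x0.
have cardn (S : {set 'I_n}) : (#|S| < n.+1)%N by rewrite ltnS -[leqRHS]card_ord max_card.
rewrite (partition_big (fun S : {set 'I_n} => Ordinal (cardn S)) xpredT)//=.
apply: eq_bigr => m _.
have wm0 : 0 <= p ^+ m * (1 - p) ^+ (n - m).
  by rewrite mulr_ge0 ?exprn_ge0 ?subr_ge0.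
transitivity (\sum_(S in [set S : {set 'I_n} | #|S| == m]%SET)
  (p ^+ m * (1 - p) ^+ (n - m))%:E * x m)%E.
  by apply: eq_big => S; [rewrite inE -val_eqE|move=> /eqP <-].
rewrite ge0_sume_const; last by rewrite mule_ge0.
by rewrite card_draws card_ord muleA -EFinM mulr_natl.
Qed.

(** * The bound for the shuffled outputs *)

Section shuffled_hockey_stick.
Local Open Scope ereal_scope.
Context (R : realType) (X : Type) d (Y : measurableType d).
Variables (mu : {measure set Y -> \bar R}) (r : X -> Y -> R) (eps0 : R).
Hypotheses (hr : local_randomizer mu r) (hLDP : LDP r eps0).
Variables (n : nat) (xs : n.-tuple X).

Local Notation W := (blanket_law mu r).
Local Notation gamma := (blanket_mass mu r).
Local Notation Wn := (independent_law (fun _ : 'I_n.+1 => W)).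

(** The distinguished user keeps the plain ratio, so that the difference of two inputs is the PARV;
    the other users get the version [gamma + leftover], whose product expands over subsets. *)
Let user_ratio x (i : 'I_n.+1) : Y -> R :=
  if unlift ord0 i is Some j then (fun y => gamma + leftover mu r (tnth xs j) y)%R
  else blanket_ratio mu r x.

Let measurable_user_ratio x i : measurable_fun setT (user_ratio x i).
Proof.
rewrite /user_ratio; case: unliftP => [j _|_].
  by apply: measurable_funD => //; exact: (measurable_leftover hr hLDP x).
exact: (measurable_blanket_ratio hr hLDP x).
Qed.

Let user_ratio_ge0 x i y : (0 <= user_ratio x i y)%R.
Proof.
rewrite /user_ratio; case: unliftP => [j _|_].
  rewrite addr_ge0 ?(leftover_ge0 hr hLDP x)// ltW//.
  exact: (blanket_mass_gt0 hr hLDP x).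
exact: (blanket_ratio_ge0 hr hLDP x).
Qed.

Let user_ratioE x i A : measurable A ->
  output_law mu r (tnth [tuple of x :: xs] i) A =
  \int[W]_(y in A) (user_ratio x i y)%:E.
Proof.
move=> mA; rewrite /user_ratio; case: unliftP => [j ->|->].
  by rewrite tnthS; exact: (output_law_leftover hr hLDP x).
by rewrite tnth0; exact: (output_law_ratio hr hLDP x).
Qed.

Definition shuffled_ratio x (t : n.+1.-tuple Y) : R :=
  (n.+1`!%:R^-1 * \sum_(s : 'S_n.+1) blanket_ratio mu r x (tnth t (s ord0)) *
    \prod_(j < n) (gamma + leftover mu r (tnth xs j) (tnth t (s (lift ord0 j)))))%R.

Let shuffled_ratioE x t : shuffled_ratio x t =
  (n.+1`!%:R^-1 * \sum_(s : 'S_n.+1) \prod_i user_ratio x i (tnth t (s i)))%R.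
Proof.
congr (_ * _)%R; apply: eq_bigr => s _.
rewrite big_ord_recl /user_ratio unlift_none; congr (_ * _)%R.
by apply: eq_bigr => j _; rewrite liftK.
Qed.

Let measurable_tnth_comp (q : Y -> R) (i : 'I_n.+1) : measurable_fun setT q ->
  measurable_fun setT (fun t : n.+1.-tuple Y => q (tnth t i)).
Proof. by move=> mq; apply: (measurableT_comp mq); exact: measurable_tnth. Qed.

Let measurable_user_prod x (s : 'S_n.+1) : measurable_fun setT
  (fun t : n.+1.-tuple Y => \prod_i user_ratio x i (tnth t (s i)))%R.
Proof. by apply: measurable_prod => i _; exact: measurable_tnth_comp. Qed.

Lemma measurable_shuffled_ratio x : measurable_fun setT (shuffled_ratio x).
Proof.
rewrite (funext (shuffled_ratioE x)); apply: measurable_funM => //.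
by apply: measurable_sum => s; exact: measurable_user_prod.
Qed.

Lemma shuffled_ratio_ge0 x t : (0 <= shuffled_ratio x t)%R.
Proof.
rewrite shuffled_ratioE mulr_ge0// sumr_ge0// => s _.
by apply: prodr_ge0 => i _.
Qed.

(** Pushing the product law forward along [s] composes its density with the inverse of [s]; the sum
    over all permutations is unchanged by inversion. *)
Lemma shuffled_density x A : measurable A ->
  shuffled mu r [tuple of x :: xs] A = \int[Wn]_(t in A) (shuffled_ratio x t)%:E.
Proof.
move=> mA.
have m1A : measurable_fun setT (fun t => (\1_A t)%:E : \bar R).
  by apply/measurable_EFinP; exact: (measurable_indic (D := setT) mA).
have mprod (s : 'S_n.+1) : measurable_fun setT
    (fun t => (\1_A t)%:E * (\prod_i user_ratio x i (tnth t (s i)))%:E).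
  by apply: emeasurable_funM => //; apply/measurable_EFinP.
have prod0 (s : 'S_n.+1) t :
    0 <= (\1_A t)%:E * (\prod_i user_ratio x i (tnth t (s i)))%:E.
  by rewrite mule_ge0// lee_fin ?prodr_ge0.
pose P := independent_law (fun i => output_law mu r (tnth [tuple of x :: xs] i)).
have PE (s : 'S_n.+1) : distribution P (permute s) A =
    \int[Wn]_t ((\1_A t)%:E *
                (\prod_i user_ratio x i (tnth t (s^-1%g i)))%:E).
  have mA' : measurable (permute s @^-1` A).
    by rewrite -[X in measurable X]setTI; exact: measurable_funPT.
  transitivity (P (permute s @^-1` A)) => //.
  rewrite (@independent_law_density _ _ _ _ W _ (user_ratio x))//; last first.
    by move=> i B mB; exact: user_ratioE.
  rewrite -[RHS](ge0_integral_permute W s)//.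
  apply: eq_integral => t _; congr (_ * _%:E).
  by apply: eq_bigr => i _; rewrite tnth_permute permKV.
transitivity ((n.+1`!%:R^-1)%:E * \sum_(s : 'S_n.+1) distribution P (permute s) A).
  by [].
under eq_bigr do rewrite PE.
rewrite (reindex_inj (@invg_inj {perm 'I_n.+1})) /=; under eq_bigr do rewrite invgK.
rewrite -ge0_integral_sum// -ge0_integralZl//; last 2 first.
- exact: emeasurable_sum.
- by move=> t _; exact: sume_ge0.
rewrite [RHS]integral_mkcond; apply: eq_integral => t _.
rewrite patch_indicE shuffled_ratioE EFinM muleCA -sumEFin; congr (_ * _).
by rewrite ge0_sume_distrr// => s _; rewrite lee_fin prodr_ge0.
Qed.

Lemma hockey_stick_shuffled_le eps x x' :
  hockey_stick (expR eps) (shuffled mu r [tuple of x :: xs])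
                          (shuffled mu r [tuple of x' :: xs]) <=
  \sum_(m < n.+1) (binomial_pmf n gamma m)%:E * (m.+1%:R^-1%:E *
    iid_sum_integral W (Num.max (0 : R))%R (PARV mu r eps x x') m.+1 0%R).
Proof.
have g0 : (0 <= gamma)%R by rewrite ltW// (blanket_mass_gt0 hr hLDP x).
have g1 : (gamma <= 1)%R by exact: (blanket_mass_le1 hr hLDP x).
have mPARV := measurable_PARV hr hLDP eps x x'.
have mmax : measurable_fun setT (Num.max (0 : R))%R by exact: measurable_maxr.
have max0 u : (0 <= Num.max (0 : R) u)%R by rewrite le_max lexx.
pose L := PARV mu r eps x x'.
pose lo (i : 'I_n.+1) : Y -> R :=
  if unlift ord0 i is Some j then leftover mu r (tnth xs j) else cst 0%R.
have mlo i : measurable_fun setT (lo i).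
  by rewrite /lo; case: unliftP => [j _|_//]; exact: (measurable_leftover hr hLDP x).
have lo0 i y : (0 <= lo i y)%R.
  by rewrite /lo; case: unliftP => [j _|_//]; exact: (leftover_ge0 hr hLDP x).
have iq z : Wn.-integrable setT
    (fun t => (shuffled_ratio z t)%:E).
  apply/integrableP; split.
    by apply/measurable_EFinP; exact: measurable_shuffled_ratio.
  under eq_integral do rewrite gee0_abs ?lee_fin ?shuffled_ratio_ge0//.
  by rewrite -shuffled_density// probability_setT ltry.
rewrite (hockey_stickE _ (iq x) (iq x') (shuffled_density x) (shuffled_density x')).
(* The factors come from averaging over permutations, from the users of S imitating the blanket, and
   from the mean over the clone set. *)
pose c (S : {set 'I_n}) : R := (n.+1`!%:R^-1 * (gamma ^+ #|S| * #|S|.+1%:R^-1))%R.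
have c0 S : (0 <= c S)%R by rewrite !mulr_ge0 ?exprn_ge0.
(* The S-term before permuting; the leading 0 in the sum is the offset of [integral_partial_sum]. *)
pose h (S : {set 'I_n}) (t : n.+1.-tuple Y) : \bar R :=
  (Num.max 0 (0 + \sum_i (if clone_set S i then L (tnth t i) else 0)) *
   \prod_i (if clone_set S i then 1 else lo i (tnth t i)))%R%:E.
have mh S : measurable_fun setT (h S).
  apply/measurable_EFinP; apply: measurable_funM.
    apply: (measurableT_comp mmax); apply: measurable_funD => //.
    apply: (@measurable_sum_tnth _ _ _ n.+1
      (fun i y => if clone_set S i then L y else 0%R)) => i.
    by case: clone_set.
  apply: (@measurable_prod_tnth _ _ _ n.+1
    (fun i y => if clone_set S i then 1 else lo i y)%R) => i.
  by case: clone_set.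
have h0 S t : 0 <= h S t.
  by rewrite lee_fin mulr_ge0// prodr_ge0// => i _; case: ifP.
have mhs S (s : 'S_n.+1) : measurable_fun setT (fun t => h S (permute s t)).
  by apply: measurableT_comp => //; exact: measurable_funPT.
have le_h t : maxe 0 ((shuffled_ratio x t)%:E - (expR eps)%:E * (shuffled_ratio x' t)%:E)
    <= \sum_(S : {set 'I_n}) (c S)%:E * \sum_(s : 'S_n.+1) h S (permute s t).
  rewrite -EFinM -EFinB -EFin_max.
  under eq_bigr do rewrite sumEFin -EFinM.
  rewrite sumEFin lee_fin.
  rewrite (_ : (shuffled_ratio x t - _)%R = (n.+1`!%:R^-1 * \sum_(s : 'S_n.+1)
      L (tnth t (s ord0)) * \prod_(j < n)
        (gamma + leftover mu r (tnth xs j) (tnth t (s (lift ord0 j)))))%R); last first.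
    rewrite /shuffled_ratio mulrCA -mulrBr mulr_sumr -sumrB; congr (_ * _)%R.
    by apply: eq_bigr => s _; rewrite /L PARVE mulrBl mulrA.
  rewrite -[X in Num.max X _](mulr0 (n.+1`!%:R^-1)%R) -maxr_pMr//.
  have := @max0_sum_perm_le R n gamma (fun k => L (tnth t k))
    (fun j k => leftover mu r (tnth xs j) (tnth t k)) g0.
  move=> /(_ (fun j k => leftover_ge0 hr hLDP x _ _)) max_le.
  have f0 : (0 <= n.+1`!%:R^-1 :> R)%R by [].
  apply: (le_trans (ler_wpM2l f0 max_le)); rewrite mulr_sumr.
  apply: ler_sum => S _; rewrite /c -!mulrA !ler_wpM2l// ?exprn_ge0//.
  rewrite le_eqVlt; apply/orP; left; apply/eqP.
  apply: eq_bigr => s _; rewrite add0r; congr (Num.max _ _ * _)%R.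
    by apply: eq_bigr => i _; rewrite tnth_permute.
  by apply: eq_bigr => i _; rewrite tnth_permute /lo; case: unliftP.
apply: (@le_trans _ _ (\int[Wn]_t
    \sum_(S : {set 'I_n}) (c S)%:E * \sum_(s : 'S_n.+1) h S (permute s t))).
  apply: ge0_le_integral => //.
  - by move=> t _; rewrite le_max lexx.
  - apply: measurable_maxe => //; apply: emeasurable_funB => //.
      by apply/measurable_EFinP; exact: measurable_shuffled_ratio.
    by apply: measurable_funeM; apply/measurable_EFinP; exact: measurable_shuffled_ratio.
  - by apply: emeasurable_sum => S; apply: measurable_funeM; exact: emeasurable_sum.
rewrite ge0_integral_sum//; last 2 first.
- by move=> S; apply: measurable_funeM; exact: emeasurable_sum.
- by move=> S t _; rewrite mule_ge0 ?sume_ge0 ?lee_fin.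
pose e m := (m.+1%:R^-1)%:E * iid_sum_integral W (Num.max (0 : R))%R L m.+1 0%R.
have e0 m : 0 <= e m by rewrite mule_ge0 ?lee_fin// iid_sum_integral_ge0.
rewrite le_eqVlt; apply/orP; left; apply/eqP.
rewrite -[RHS](@sum_subsets_binomial _ n gamma e) ?g0//.
apply: eq_bigr => S _.
rewrite ge0_integralZl//; last 3 first.
- exact: emeasurable_sum.
- by move=> t _; exact: sume_ge0.
- by rewrite lee_fin.
rewrite ge0_integral_sum//.
(* By exchangeability all (n + 1)! permuted terms have the same integral, and their number cancels
   the normalisation in [c]. *)
under eq_bigr do rewrite ge0_integral_permute//.
(* Each of the n - |S| users outside S contributes the mass 1 - gamma of its leftover; the |S| + 1
   clones remain in the sum. *)
have -> : \int[Wn]_t h S t = ((1 - gamma) ^+ (n - #|S|))%:E *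
    iid_sum_integral W (Num.max (0 : R))%R L #|S|.+1 0%R.
  rewrite -sum_clone_setC -[in RHS]sum_clone_set.
  apply: integral_partial_sum => //; first by rewrite subr_ge0.
  move=> i; rewrite /lo /clone_set; case: unliftP => [j _ _|_//].
  exact: (integral_leftover hr hLDP x).
rewrite ge0_sume_const; last first.
  by rewrite mule_ge0 ?iid_sum_integral_ge0// lee_fin exprn_ge0// subr_ge0.
rewrite card_Sn !muleA -!EFinM; congr (_%:E * _).
rewrite /c.
have fn0 : (n.+1`!%:R != 0 :> R)%R by rewrite pnatr_eq0 -lt0n fact_gt0.
by rewrite (mulrAC (n.+1`!%:R^-1)%R) mulVf// mul1r mulrAC.
Qed.

End shuffled_hockey_stick.

(** * Matching the two binomial sums, and the conclusion *)

Lemma sum_binomial_pmf_shift (R : realType) n (p : R) (x : nat -> \bar R) :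
  0 < p <= 1 -> (forall m, 0 <= x m)%E -> x 0%N = 0%E ->
  ((n.+1%:R^-1)%:E *
     \sum_(m < n.+2) (binomial_pmf n.+1 p m)%:E * (p^-1%:E * x m) =
   \sum_(m < n.+1) (binomial_pmf n p m)%:E * (m.+1%:R^-1%:E * x m.+1))%E.
Proof.
move=> /andP[p0 p1] x0 x00.
have pmf0 k m : (0 <= (binomial_pmf k p m)%:E)%E.
  by rewrite lee_fin binomial_pmf_ge0// p1 ltW.
have pV0 : (0 <= p^-1%:E)%E by rewrite lee_fin invr_ge0 ltW.
(* The term at 0 vanishes, and the rest is reindexed by m + 1; the identity (n + 1) C(n, m) = (m +
   1) C(n + 1, m + 1) then matches the terms. *)
rewrite big_ord_recl x00 !mule0 add0e ge0_sume_distrr; last first.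
  by move=> m _; rewrite !mule_ge0.
apply: eq_bigr => m _; rewrite lift0 !muleA -!EFinM; congr (_%:E * _)%E.
rewrite /binomial_pmf subSS -[_ *+ 'C(n.+1, _)]mulr_natr -[_ *+ 'C(n, _)]mulr_natr.
have binE : n.+1%:R * 'C(n, m)%:R = m.+1%:R * 'C(n.+1, m.+1)%:R :> R.
  by rewrite -!natrM mul_bin_diag.
have -> : 'C(n.+1, m.+1)%:R = n.+1%:R * 'C(n, m)%:R / m.+1%:R :> R.
  by rewrite binE mulrAC mulfV ?mul1r// pnatr_eq0.
rewrite exprS; field.
by apply/and3P; split; rewrite ?nat1r ?pnatr_eq0 ?gt_eqF.
Qed.

Theorem theorem13 (R : realType) (X : Type)
    (d : measure_display) (Y : measurableType d)
    (mu : {measure set Y -> \bar R})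
    (r : X -> Y -> R) (eps0 eps : R)
    (hr : local_randomizer mu r) (eps0_ge0 : 0 <= eps0) (hLDP : LDP r eps0)
    (eps_ge0 : 0 <= eps)
    (n' : nat) (x10 x11 : X) (xs : n'.-tuple X) (x10_neq_x11 : x10 <> x11)
    (dO : measure_display) (Omega : measurableType dO) (P : probability Omega R)
    (G : nat -> {RV P >-> R})
    (hG : iid_copies G (GPARV_law mu r eps x10 x11)) :
  let M x := shuffled mu r [tuple of x :: xs] in
  let PB := blanket_pair mu r n'.+1 in
  (hockey_stick (expR eps) (M x10) (M x11) <= hockey_stick (expR eps) (PB x10) (PB x11))%E /\
  hockey_stick (expR eps) (PB x10) (PB x11) =
    ((n'.+1%:R^-1)%:E *
     'E_P[fun w => (Num.max 0 (\sum_(i < n'.+1) G i w))%R])%E.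
Proof.
have hE : hockey_stick (expR eps) (blanket_pair mu r n'.+1 x10)
    (blanket_pair mu r n'.+1 x11) = _ := hockey_stick_blanket_pair hr hLDP n' eps x10 x11.
split; first by rewrite hE; exact: (hockey_stick_shuffled_le hr hLDP xs).
rewrite hE (expectation_sum_GPARV hr hLDP n'.+1 hG); apply/esym.
(* The sequence is psi_m; psi_0 = 0, being the positive part of an empty sum. *)
apply: (@sum_binomial_pmf_shift _ _ _ (fun m => iid_sum_integral
  (blanket_law mu r) (Num.max (0 : R)) (PARV mu r eps x10 x11) m 0)).
- by rewrite (blanket_mass_gt0 hr hLDP x10) (blanket_mass_le1 hr hLDP x10).
- by move=> m; apply: iid_sum_integral_ge0 => u; rewrite le_max lexx.
- rewrite /iid_sum_integral integral0_eq// => t _.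
  by rewrite big_ord0 addr0 maxxx.
Qed.
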